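(* If $0<\alpha<1$, then $L^{\alpha,\infty}\hookrightarrow C^\alpha$. If $\alpha\ge1$, then $L^{\alpha,\infty}\hookrightarrow C^\beta$ for all $0<\beta<1$. In particular, functions in $L^{\alpha,\infty}$ are continuous for all $\alpha>0$ (after possible modification on a null set).
   Context: Setting: $(X,d,m)$ is a metric space with a Borel measure $m$ such that $m(X)=\infty$ and, for some $N>0$ (Ahlfors $N$-regularity), $c^{-1}r^N\le m(B(x,r))\le c\,r^N$ for all $x\in X$, $r>0$, with $c$ independent of $x,r$. Approximation of the identity: fix a non-negative decreasing $C^\infty$ function $h:[0,\infty)\to\mathbb{R}$ with $h\equiv1$ on $[0,1/2]$ and $h\equiv0$ on $[2,\infty)$. For $t>0$ let $T_tf(x)=t^{-N}\int_X h(d(x,y)/t)f(y)\,dm(y)$, $\varphi(x,t)=1/T_t1(x)$, $\psi(x,t)=1/T_t\left(\frac{1}{T_t1}\right)(x)$, and $$s(x,y,t)=\frac{\varphi(x,t)\varphi(y,t)}{t^{2N}}\int_X h\left(\tfrac{d(x,z)}{t}\right)h\left(\tfrac{d(y,z)}{t}\right)\psi(z,t)\,dm(z).$$ Bessel potential: for $\alpha>0$, $k_\alpha(x,y)=\alpha\int_0^\infty\frac{t^\alpha}{(1+t^\alpha)^2}s(x,y,t)\frac{dt}{t}$ and $J_\alpha g(x)=\int_X g(z)k_\alpha(x,z)\,dm(z)$; $J_\alpha$ is a contraction on $L^p$, $1\le p\le\infty$. Potential space: $L^{\alpha,\infty}=J_\alpha(L^\infty)$ with norm $\|f\|_{\alpha,\infty}=\|f\|_\infty+\inf\{\|g\|_\infty: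 g\in L^\infty,\ J_\alpha g=f\}$. $C^\beta$ is the space of bounded Lipschitz-$\beta$ functions, with norm $\|f\|_\infty+[f]_\beta$, $[f]_\beta=\sup_{x\neq y}|f(x)-f(y)|/d(x,y)^\beta$. $A\hookrightarrow B$ means $A\subset B$ with continuous inclusion (functions being identified if equal a.e.). *)

(* Defs.v *)
From HB Require Import structures.
From mathcomp Require Import all_boot all_order all_algebra.
From mathcomp Require Import all_classical all_reals all_analysis.

Set Implicit Arguments.
Unset Strict Implicit.
Unset Printing Implicit Defensive.

Import Order.TTheory GRing.Theory Num.Theory.
Import numFieldNormedType.Exports.

Local Open Scope classical_set_scope.
Local Open Scope ring_scope.

(* The metric and the sigma-algebra are not related by this structure: that the
   latter is the Borel one is the predicate [borel_sigma_algebra]. *)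
#[short(type="measurableMetricType")]
HB.structure Definition MeasurableMetric (d : measure_display)
    (R : numDomainType) :=
  { X of Measurable d X & Metric R X }.

Definition borel_sigma_algebra (d : measure_display) (R : realType)
    (X : measurableMetricType d R) : Prop :=
  @measurable d X = <<s [set U : set X | open U] >>.

(* [ball x r] is the open ball [set y | mdist x y < r]. *)
Definition ahlfors_regular (d : measure_display) (R : realType)
    (X : measurableMetricType d R) (m : {measure set X -> \bar R}) (N : R)
    : Prop :=
  exists2 c : R, 0 < c & forall (x : X) (r : R), 0 < r ->
    ((c^-1 * r `^ N)%:E <= m (ball x r) <= (c * r `^ N)%:E)%E.

(* A profile on [0, oo[ is encoded as a function R -> R whose values on negative
   reals are irrelevant.  Smoothness at 0 need not be required, since the
   function is constant on [0, 1/2]. *)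
Definition cutoff (R : realType) (h : R -> R) : Prop :=
  [/\ forall r, 0 <= r -> 0 <= h r,
      forall r r', 0 <= r -> r <= r' -> h r' <= h r,
      forall (n : nat) (r : R), 0 < r -> derivable (derive1n n h) r 1,
      forall r, 0 <= r -> r <= 2^-1 -> h r = 1
    & forall r, 2 <= r -> h r = 0].

Section potential_spaces.
Context (d : measure_display) (R : realType) (X : measurableMetricType d R).
Variables (m : {measure set X -> \bar R}) (N : R) (h : R -> R).

Definition avg (t : R) (f : X -> R) (x : X) : R :=
  t `^ (- N) * \int[m]_y (h (mdist x y / t) * f y).

Definition phi (x : X) (t : R) : R := 1 / avg t (fun=> 1) x.

Definition psi (x : X) (t : R) : R :=
  1 / avg t (fun y => 1 / avg t (fun=> 1) y) x.

Definition approx_id (x y : X) (t : R) : R :=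
  phi x t * phi y t / t `^ (2 * N) *
  \int[m]_z (h (mdist x z / t) * h (mdist y z / t) * psi z t).

(* Extended-real valued: the integral may diverge on the diagonal. *)
Definition bessel_kernel (alpha : R) (x y : X) : \bar R :=
  (alpha%:E * \int[lebesgue_measure]_(t in `]0%R, +oo[)
     (t `^ alpha / (1 + t `^ alpha) ^+ 2 * approx_id x y t / t)%:E)%E.

Definition bessel_potential (alpha : R) (g : X -> R) (x : X) : \bar R :=
  (\int[m]_z ((g z)%:E * bessel_kernel alpha x z))%E.

Definition is_bessel_potential (alpha : R) (g f : X -> R) : Prop :=
  (EFin \o f) = bessel_potential alpha g %[ae m].

Definition potential_space (alpha : R) : set (X -> R) :=
  [set f | exists2 g, g \in Lfun m +oo%E & is_bessel_potential alpha g f].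

Definition potential_norm (alpha : R) (f : X -> R) : \bar R :=
  ('N[m]_+oo[EFin \o f] +
   ereal_inf [set 'N[m]_+oo[EFin \o g] | g in
     [set g : X -> R | g \in Lfun m +oo%E /\ is_bessel_potential alpha g f]])%E.

Definition holder_space (beta : R) : set (X -> R) :=
  [set f | (exists M : R, forall x, `|f x| <= M) /\
           (exists L : R, forall x y, `|f x - f y| <= L * mdist x y `^ beta)].

Definition holder_norm (beta : R) (f : X -> R) : \bar R :=
  (ereal_sup [set (`|f x|)%:E | x in [set: X]] +
   ereal_sup [set (`|f p.1 - f p.2| / mdist p.1 p.2 `^ beta)%:E |
                p in [set p : X * X | p.1 != p.2]])%E.

(* Continuous inclusion of [A] into [B], with norms [nA] and [nB], for functions
   identified when they are equal [m]-almost everywhere. *)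
Definition continuously_embeds (A : set (X -> R)) (nA : (X -> R) -> \bar R)
    (B : set (X -> R)) (nB : (X -> R) -> \bar R) : Prop :=
  exists C : R, forall f, A f ->
    exists f' : X -> R, [/\ B f', f = f' %[ae m] & (nB f' <= C%:E * nA f)%E].

End potential_spaces.

(* Main.v *)
(* The kernel s(x, z, t) is nonnegative, of size at most B t^-N, supported in
   d(x, z) < 4 t and Lipschitz in x with constant B t^(-N-1).  By Ahlfors
   regularity the L^1 norm in z of s(x, ., t) - s(y, ., t) is therefore at most a
   constant times min(1, d(x, y) / t).  Since t^alpha / (1 + t^alpha)^2 <= t^beta
   whenever 0 < beta <= alpha, Tonelli's theorem on X x ]0, oo[ bounds
   |J g(x) - J g(y)| by a constant times |g|_oo times the integral of
   t^(beta - 1) min(1, d(x, y) / t), which is O(d(x, y)^beta) for 0 < beta < 1.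
   This covers both cases: beta = alpha if alpha < 1, any beta < 1 otherwise.
   Two continuous functions equal a.e. are equal because balls have positive
   measure, so the continuous representative does not depend on g. *)

Require Import Defs.
From HB Require Import structures.
From mathcomp Require Import all_boot all_order all_algebra.
From mathcomp Require Import all_classical all_reals all_analysis.
From mathcomp Require Import measurable_realfun ess_sup_inf.
From mathcomp Require Import ring lra.

Set Implicit Arguments.
Unset Strict Implicit.
Unset Printing Implicit Defensive.

Import Order.TTheory GRing.Theory Num.Theory.
Import numFieldNormedType.Exports.

Local Open Scope classical_set_scope.
Local Open Scope ring_scope.

(** * Powers and the cutoff *)

(** Two obstacles shape the proof. Tonelli requires [s x z t] to be jointly measurable in (z, t),
    and [s] is built by repeated averages, reciprocals and products. The class [tame] collects
    properties that survive these operations: measurability in the point, two-sided bounds uniform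
    in the scale, continuity in the scale. Positive lower bounds are what permits the reciprocals in
    [phi] and [psi], and joint measurability then follows as for Caratheodory functions. Secondly,
    [bessel_kernel] may be infinite, so the difference of two kernels need not make sense at every
    z. The difference is therefore taken inside the t-integral, in the nonnegative function [Delta],
    and compared with the kernels only at those z where both are finite. These are almost all z,
    because the kernel is integrable in z. *)

Section power_integrals.
Context (R : realType).
Local Notation leb := (@lebesgue_measure R).

Lemma derivable_powR_gt0 (a x : R) : 0 < x -> derivable (@powR R ^~ a) x 1.
Proof. by move=> x0; apply: ex_derive; exact: is_derive1_powR. Qed.

Lemma continuous_powR (a x : R) : 0 < x -> {for x, continuous (@powR R ^~ a)}.
Proof.
move=> x0; apply: differentiable_continuous; apply/derivable1_diffP.
exact: derivable_powR_gt0.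
Qed.

Lemma powR_cvgy0 (a : R) : 0 < a -> x `^ (- a) @[x --> +oo] --> (0 : R).
Proof.
move=> a0; have -> : (0 : R) = 0 * 1 by rewrite mul0r.
apply/cvgrPdist_le => /= e e0; near=> x.
have x1 : 1 <= x by near: x; apply: nbhs_pinfty_ge; rewrite num_real.
have xe : e `^ (- a^-1) <= x by near: x; apply: nbhs_pinfty_ge; rewrite num_real.
rewrite mulr1 sub0r normrN ger0_norm ?powR_ge0//.
have /(_ (e `^ (- a^-1)) x) := @ge0_ler_powR R a (ltW a0).
rewrite !nnegrE powR_ge0 (le_trans ler01 x1) => /(_ isT isT xe).
rewrite -powRrM mulNr mulVf ?gt_eqF// (powR_inv1 (ltW e0)) powRN => ex.
by rewrite -[e]invrK lef_pV2// posrE ?invr_gt0// powR_gt0// (lt_le_trans ltr01).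
Unshelve. all: by end_near. Qed.

(** For g < 1 the integrand blows up at 0, so the fundamental theorem is applied on
    [[d / (n + 2), d]] and monotone convergence does the rest. The antiderivative at the left end is
    nonnegative and is dropped, hence an inequality. *)
Lemma integral_powR_near0 (g d : R) : 0 < g -> 0 < d ->
  (\int[leb]_(t in `]0%R, d]) (t `^ (g - 1))%:E <= (d `^ g / g)%:E)%E.
Proof.
(* The shift by 2 keeps the left end strictly below d already for n = 0. *)
move=> g0 d0; pose A n : set R := `[d / n.+2%:R, d]%classic.
have dn0 n : 0 < d / n.+2%:R by rewrite divr_gt0.
have bigA : \bigcup_n A n = `]0, d]%classic.
  apply/seteqP; split=> [x [n _]|x]; rewrite /A/= !in_itv/=.
    by move=> /andP[nx ->]; rewrite (lt_le_trans (dn0 n)).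
  move=> /andP[x0 xd]; exists (Num.truncn (d / x)) => //=.
  rewrite in_itv/= xd andbT ler_pdivrMr// mulrC -ler_pdivrMr//.
  apply: (le_trans (ltW (truncnS_gt _))).
  by rewrite ler_nat.
have mp (D : set R) : measurable_fun D (EFin \o (fun t : R => t `^ (g - 1))).
  apply: measurable_funTS; apply/measurable_EFinP; exact: measurable_powR.
have ndA : nondecreasing_seq A.
  move=> m n mn; apply/subsetPset => x; rewrite /A/= !in_itv/= => /andP[mx ->].
  rewrite andbT (le_trans _ mx)// ler_pM2l// lef_pV2 ?posrE//.
  by rewrite ler_nat.
have cv := @ge0_nondecreasing_set_cvg_integral _ (measurableTypeR R) R A
  (EFin \o (fun t : R => t `^ (g - 1))) leb ndA
  (fun=> measurable_itv _) (fun i => mp (A i)) (fun i x _ => powR_ge0 _ _).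
rewrite -bigA -(cvg_lim _ cv)//; apply: lime_le.
  by apply/cvg_ex; eexists; exact: cv.
apply: nearW => n.
rewrite (@continuous_FTC2 _ _ (fun t => t `^ g / g)).
+ by rewrite -EFinB lee_fin gerBl// divr_ge0 ?powR_ge0// ltW.
+ by rewrite ltr_pdivrMr// ltr_pMr// ltr1n.
+ apply: continuous_in_subspaceT => x; rewrite inE/= in_itv/= => /andP[nx _].
  by apply: continuous_powR; rewrite (lt_le_trans (dn0 n)).
+ split.
  * move=> x; rewrite in_itv/= => /andP[nx _].
    apply: derivableM => //; apply: derivable_powR_gt0.
    by rewrite (lt_trans (dn0 n)).
  * apply: cvg_at_right_filter; apply: cvgMr_tmp.
    exact: continuous_powR.
  * apply: cvg_at_left_filter; apply: cvgMr_tmp.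
    exact: continuous_powR.
+ move=> x; rewrite in_itv/= => /andP[nx _].
  have x0 : 0 < x by rewrite (lt_trans (dn0 n)).
  rewrite derive1E deriveM//; last exact: derivable_powR_gt0.
  rewrite derive_cst scaler0 add0r; have [_ ->] := is_derive1_powR g x0.
  by rewrite /GRing.scale/=; field; rewrite gt_eqF.
Qed.

Lemma integral_powR_infty (g d : R) : 0 < g -> 0 < d ->
  (\int[leb]_(t in `[d, +oo[) (t `^ (- g - 1))%:E = (d `^ (- g) / g)%:E)%E.
Proof.
move=> g0 d0.
rewrite (@ge0_continuous_FTC2y _ _ (fun t => t `^ (- g) / (- g)) _ 0).
- by rewrite -EFinB sub0r invrN mulrN opprK.
- by move=> x _; exact: powR_ge0.
- apply: continuous_in_subspaceT => x; rewrite inE/= in_itv/= andbT => nx.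
  by apply: continuous_powR; rewrite (lt_le_trans d0).
- by rewrite -(mul0r (- g)^-1); apply: cvgMr_tmp; exact: powR_cvgy0.
- move=> x nx; apply: derivableM => //; apply: derivable_powR_gt0.
  exact: lt_trans d0 nx.
- by apply: cvg_at_right_filter; apply: cvgMr_tmp; exact: continuous_powR.
- move=> x; rewrite in_itv/= andbT => nx.
  have x0 : 0 < x by rewrite (lt_trans d0).
  rewrite derive1E deriveM//; last exact: derivable_powR_gt0.
  rewrite derive_cst scaler0 add0r; have [_ ->] := is_derive1_powR (- g) x0.
  by rewrite /GRing.scale/=; field; rewrite gt_eqF.
Qed.

End power_integrals.

Section cutoff_lemmas.
Context (R : realType) (h : R -> R).
Hypothesis hcut : cutoff h.

Lemma cutoff_ge0 r : 0 <= r -> 0 <= h r.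
Proof. by case: hcut => + _ _ _ _; exact. Qed.

Lemma cutoff_near0 r : 0 <= r -> r <= 2^-1 -> h r = 1.
Proof. by case: hcut => _ _ _ + _; exact. Qed.

Lemma cutoff_far r : 2 <= r -> h r = 0.
Proof. by case: hcut => _ _ _ _; exact. Qed.

Lemma cutoff_le1 r : 0 <= r -> h r <= 1.
Proof.
move=> r0; rewrite -(@cutoff_near0 0)//.
by case: hcut => _ + _ _ _; exact.
Qed.

(** The derivative is continuous, hence bounded, on the compact interval [1/4, 3], and [h] is
    constant on either side of it; the mean value theorem on that interval is enough. *)
Lemma cutoff_lipschitz : exists2 L, 0 < L &
  forall a b : R, 0 <= a -> 0 <= b -> `|h a - h b| <= L * `|a - b|.
Proof.
have [_ _ hd _ _] := hcut.
have dh (x : R) : 0 < x -> is_derive x 1 h (h^`()%classic x).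
  by move=> x0; rewrite derive1E; apply/derivableP; exact: (hd 0%N).
have ch' : {within `[4^-1, 3], continuous (fun x => `|h^`()%classic x|)}.
  apply: continuous_in_subspaceT => x; rewrite inE/= in_itv/= => /andP[x4 _].
  apply: continuous_comp; last exact: norm_continuous.
  apply: differentiable_continuous; apply/derivable1_diffP.
  by apply: (hd 1%N); rewrite (lt_le_trans _ x4).
have q3 : 4^-1 <= 3 :> R by lra.
have [x0 _ Lmax] := EVT_max q3 ch'.
pose L := `|h^`()%classic x0| + 1.
have L0 : 0 < L by rewrite /L ltr_wpDl.
have lip (a b : R) : 4^-1 <= a -> a < b -> b <= 3 -> `|h b - h a| <= L * (b - a).
  move=> a4 ab b3.
  have [||c] := @MVT _ h (h^`()%classic) a b ab.
  - by move=> x; rewrite in_itv/= => /andP[ax _]; apply: dh; lra.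
  - apply: derivable_within_continuous => x; rewrite in_itv/= => /andP[ax _].
    by apply: (hd 0%N); lra.
  - rewrite in_itv/= => /andP[ac cb] ->.
    have ba0 : 0 <= b - a by rewrite subr_ge0 ltW.
    rewrite normrM [`|b - a|]ger0_norm// ler_wpM2r//.
    apply: (le_trans (Lmax c _)); last by rewrite /L lerDl.
    by rewrite in_itv/=; apply/andP; split; lra.
(* Truncation to [1/4, 3] is 1-Lipschitz and leaves [h] unchanged, both ends lying in regions where
   [h] is constant. It also stays away from 0, where no derivative is assumed. *)
pose clamp r : R := Num.min 3 (Num.max 4^-1 r).
have hclamp (r : R) : 0 <= r -> h r = h (clamp r).
  move=> r0; rewrite /clamp; case: (leP 4^-1 r) => r4.
    case: (leP 3 r) => r3; last by [].
    by rewrite !cutoff_far//; lra.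
  by rewrite min_r; [rewrite !cutoff_near0//; lra|lra].
have cl_ge (r : R) : 4^-1 <= clamp r.
  by rewrite /clamp le_min; apply/andP; split; [lra|rewrite le_max lexx].
have cl_le (r : R) : clamp r <= 3 by rewrite /clamp ge_min lexx.
have cl1 (a b : R) : a <= b -> clamp a <= clamp b /\ clamp b - clamp a <= b - a.
  move=> ab; rewrite /clamp.
  have [m1 m2] : Num.max 4^-1 a <= Num.max 4^-1 b /\
      Num.max 4^-1 b - Num.max 4^-1 a <= b - a.
    by case: (leP 4^-1 a) => ?; case: (leP 4^-1 b) => ?; split; lra.
  move: (Num.max _ a) (Num.max _ b) m1 m2 => u v m1 m2.
  by case: (leP 3 u) => ?; case: (leP 3 v) => ?; split; lra.
exists L => // a b a0 b0.
wlog ab : a b a0 b0 / a <= b.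
  move=> H; case: (leP a b) => [|/ltW] ab; first exact: H.
  by rewrite distrC [`|a - b|]distrC; exact: H.
rewrite distrC [`|a - b|]distrC (hclamp a)// (hclamp b)//.
have [c1 c2] := cl1 _ _ ab.
rewrite [`|b - a|]ger0_norm ?subr_ge0//.
apply: (@le_trans _ _ (L * (clamp b - clamp a))); last by rewrite (ler_wpM2l (ltW L0)).
move: c1; rewrite le_eqVlt => /predU1P[->|c1]; first by rewrite !subrr normr0 mulr0.
exact: lip.
Qed.

End cutoff_lemmas.

(** * Borel measurability on the metric space *)

Section dominated_by_indicator.
Context (d : measure_display) (T : measurableType d) (R : realType).
Variables (mu : {measure set T -> \bar R}) (A : set T) (K M : R) (f : T -> R).
Hypotheses (mA : measurable A) (muA : (mu A <= K%:E)%E).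
Hypotheses (mf : measurable_fun setT f).
Hypothesis (fM : forall y, `|f y| <= M * \1_A y).

(** The form in which upper Ahlfors regularity enters the estimates: an integrand of size [M]
    supported in a set of measure at most [K], later a ball or a union of two balls. *)
Lemma ge0_integral_le_indic : 0 <= M ->
  (\int[mu]_y (`|f y|)%:E <= (M * K)%:E)%E.
Proof.
move=> M0; apply: (@le_trans _ _ (\int[mu]_y (M%:E * (\1_A y)%:E))%E).
  apply: ge0_le_integral => //=.
  - by do 2 apply: measurableT_comp => //.
  - by apply/measurable_EFinP; apply: measurable_funM.
  - by move=> y _; rewrite -EFinM lee_fin.
rewrite ge0_integralZl//; last by apply/measurable_EFinP.
by rewrite integral_indic// setIT EFinM lee_wpmul2l// lee_fin.
Qed.

Lemma integrable_le_indic : 0 <= M -> mu.-integrable setT (EFin \o f).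
Proof.
move=> M0; apply/integrableP; split; first exact/measurable_EFinP.
by apply: (le_lt_trans (ge0_integral_le_indic M0)); rewrite ltry.
Qed.

Lemma Rintegral_le_indic : 0 <= M -> `|\int[mu]_y f y| <= M * K.
Proof.
move=> M0; apply: le_trans (le_normr_Rintegral _ (integrable_le_indic M0)) _ => //.
rewrite -lee_fin /Rintegral fineK; first exact: ge0_integral_le_indic.
rewrite ge0_fin_numE; last exact: integral_ge0.
by apply: (le_lt_trans (ge0_integral_le_indic M0)); rewrite ltry.
Qed.

End dominated_by_indicator.

Section borel_metric.
Context (d : measure_display) (R : realType) (X : measurableMetricType d R).
Hypothesis borelX : borel_sigma_algebra X.

Lemma open_borel (U : set X) : open U -> measurable U.
Proof.
move=> oU; have : <<s [set U : set X | open U] >> U.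
  exact: sub_sigma_algebra.
by rewrite -borelX.
Qed.

Lemma open_mball (x : X) (r : R) : open (ball x r).
Proof.
rewrite openE => y; rewrite ballEmdist /= => xy.
apply/nbhs_ballP; exists (r - mdist x y) => /=; first by rewrite subr_gt0.
move=> z; rewrite !ballEmdist /= ltrBrDl => yz.
exact: le_lt_trans (metric_triangle x y z) yz.
Qed.

Lemma measurable_mball (x : X) (r : R) : measurable (ball x r).
Proof. exact/open_borel/open_mball. Qed.

Lemma lipschitz_continuous (f : X -> R) (K : R) :
  (forall x y, `|f x - f y| <= K * mdist x y) -> continuous f.
Proof.
move=> fK x; apply/cvgrPdist_lt => e e0.
have K0 : 0 < `|K| + 1 by rewrite ltr_wpDl.
apply/nbhs_ballP; exists (e / (`|K| + 1)) => /=; first by rewrite divr_gt0.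
move=> y; rewrite ballEmdist/= ltr_pdivlMr// => xy.
apply: (le_lt_trans (fK x y)); apply: le_lt_trans xy.
rewrite mulrC ler_wpM2l ?mdist_ge0// (le_trans (ler_norm K))// lerDl//.
Qed.

Lemma continuous_borel (f : X -> R) : continuous f -> measurable_fun setT f.
Proof.
move=> /continuousP cf; apply: (measurability _ (RGenOpens.measurableE R)).
move=> _ [_ [a [b ->] <-]]; rewrite setTI; apply: open_borel.
exact/cf/interval_open.
Qed.

Lemma lipschitz_borel (f : X -> R) (K : R) :
  (forall x y, `|f x - f y| <= K * mdist x y) -> measurable_fun setT f.
Proof. by move=> fK; apply: continuous_borel; exact: lipschitz_continuous fK. Qed.

Lemma mdist_contract (x y z : X) : `|mdist x z - mdist y z| <= mdist x y.
Proof.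
rewrite ler_norml lerBlDr metric_triangle lerNl opprB lerBlDr andbT.
by rewrite (metric_sym x y) metric_triangle.
Qed.

End borel_metric.

(** * Averages at scale t *)

Section averages.
Context (d : measure_display) (R : realType) (X : measurableMetricType d R).
Variables (m : {measure set X -> \bar R}) (N : R) (h : R -> R) (c L : R).
Hypotheses (borelX : borel_sigma_algebra X) (L0 : 0 < L).
Hypothesis regm : forall (x : X) (r : R), 0 < r ->
  ((c^-1 * r `^ N)%:E <= m (ball x r) <= (c * r `^ N)%:E)%E.
Hypothesis hcut : cutoff h.
Hypothesis lip_h : forall a b : R, 0 <= a -> 0 <= b -> `|h a - h b| <= L * `|a - b|.

Local Notation bump x t y := (h (mdist x y / t)).

Lemma bump_ge0 (x y : X) (t : R) : 0 < t -> 0 <= bump x t y.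
Proof. by move=> t0; rewrite (cutoff_ge0 hcut)// divr_ge0 ?mdist_ge0// ltW. Qed.

Lemma bump_le1 (x y : X) (t : R) : 0 < t -> bump x t y <= 1.
Proof. by move=> t0; rewrite (cutoff_le1 hcut)// divr_ge0 ?mdist_ge0// ltW. Qed.

Lemma bump_far (x y : X) (t : R) : 0 < t -> 2 * t <= mdist x y -> bump x t y = 0.
Proof. by move=> t0 xy; rewrite (cutoff_far hcut)// ler_pdivlMr. Qed.

Lemma bump_near (x y : X) (t : R) : 0 < t -> mdist x y <= t / 2 -> bump x t y = 1.
Proof.
move=> t0 xy; rewrite (cutoff_near0 hcut) ?divr_ge0 ?mdist_ge0 ?(ltW t0)//.
by rewrite ler_pdivrMr// mulrC.
Qed.

Lemma bump_lip (x x' y : X) (t : R) : 0 < t ->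
  `|bump x t y - bump x' t y| <= L * (mdist x x' / t).
Proof.
move=> t0; apply: (le_trans (lip_h _ _)); rewrite ?divr_ge0 ?mdist_ge0 ?(ltW t0)//.
rewrite (ler_wpM2l (ltW L0))// -mulrBl normrM [`|t^-1|]ger0_norm ?invr_ge0 ?(ltW t0)//.
by rewrite ler_wpM2r ?invr_ge0 ?(ltW t0)// mdist_contract.
Qed.

Lemma bump_sym (x y : X) (t : R) : bump x t y = bump y t x.
Proof. by rewrite metric_sym. Qed.

Lemma measurable_bump (x : X) (t : R) : 0 < t -> measurable_fun setT (fun y => bump x t y).
Proof.
move=> t0; apply: (lipschitz_borel borelX (K := L / t)) => y z.
rewrite bump_sym [in X in _ - X]bump_sym; apply: (le_trans (bump_lip _ _ _ t0)).
by rewrite mulrA mulrAC.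
Qed.

Lemma continuous_bump (x y : X) (t : R) : 0 < t -> {for t, continuous (fun s : R => bump x s y)}.
Proof.
move=> t0; have := mdist_ge0 x y; rewrite le_eqVlt => /predU1P[<-|xy0].
  rewrite (_ : (fun s : R => h (0 / s)) = cst (h 0)); first exact: cst_continuous.
  by apply/funext => s; rewrite mul0r.
apply: (@continuous_comp _ _ _ (fun s : R => mdist x y / s) h).
  by apply: cvgMl_tmp; apply: cvgV => //; rewrite gt_eqF.
apply: differentiable_continuous; apply/derivable1_diffP.
by have [_ _ hder _ _] := hcut; apply: (hder 0%N); rewrite divr_gt0.
Qed.

Lemma ball_le (x : X) (a t : R) : 0 < a -> 0 < t ->
  (m (ball x (a * t)) <= (c * a `^ N * t `^ N)%:E)%E.
Proof.
move=> a0 t0; have /andP[_] := regm x (mulr_gt0 a0 t0).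
by rewrite powRM ?mulrA// ltW.
Qed.

Lemma ball2_le (x y : X) (a t : R) : 0 < a -> 0 < t ->
  (m (ball x (a * t) `|` ball y (a * t)) <= (2 * (c * a `^ N) * t `^ N)%:E)%E.
Proof.
move=> a0 t0; apply: (le_trans (measureU2 _ _ _)); do ?exact: measurable_mball.
by rewrite -mulrA mulr_natl mulr2n EFinD leeD// ball_le.
Qed.

Section fixed_scale.
Variables (t : R) (F : X -> R) (M : R).
Hypotheses (t0 : 0 < t) (mF : measurable_fun setT F).
Hypothesis (FM : forall y, `|F y| <= M).

(** The sign of [M] comes from a value of [F], so a point of [X] has to be supplied. *)
Let M0 : X -> 0 <= M.
Proof. by move=> x; exact: le_trans (FM x). Qed.

Let bumpM_dom x y : `|bump x t y * F y| <= M * \1_(ball x (2 * t)) y.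
Proof.
rewrite normrM ger0_norm ?bump_ge0// indicE; case: (boolP (y \in _)) => /=.
  by move=> _; rewrite mulr1 -[leRHS]mul1r ler_pM// ?bump_ge0// bump_le1.
rewrite notin_setE ballEmdist/= => /negP; rewrite -leNgt => xy.
by rewrite bump_far// mul0r mulr0.
Qed.

Let measurable_bumpM x : measurable_fun setT (fun y => bump x t y * F y).
Proof. by apply: measurable_funM => //; exact: measurable_bump. Qed.

Lemma integrable_bumpM x : m.-integrable setT (EFin \o (fun y => bump x t y * F y)).
Proof.
apply: (integrable_le_indic (measurable_mball borelX x (2 * t)) (ball_le _ _ t0) _
  (bumpM_dom x)) => //; exact: M0 x.
Qed.

(** The difference of the two bumps is at most [L * (mdist x x' / t)] and lives on two balls of
    radius 2t, of total measure at most [2 c (2 t)^N], which cancels the factor [t^-N]. *)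
Lemma avg_lipschitz x x' : `|avg m N h t F x - avg m N h t F x'| <=
  2 * (c * 2 `^ N) * L * M / t * mdist x x'.
Proof.
rewrite /avg -mulrBr -RintegralB//; try exact: integrable_bumpM.
rewrite normrM ger0_norm ?powR_ge0//.
under eq_Rintegral do rewrite -mulrBl.
have tN0 : 0 < t `^ N by exact: powR_gt0.
rewrite powRN ler_pdivrMl//.
have -> : t `^ N * (2 * (c * 2 `^ N) * L * M / t * mdist x x') =
  (L * (mdist x x' / t) * M) * (2 * (c * 2 `^ N) * t `^ N) by ring.
apply: (@Rintegral_le_indic _ _ _ _ (ball x (2 * t) `|` ball x' (2 * t))).
- by apply: measurableU; exact: measurable_mball.
- exact: ball2_le.
- apply: measurable_funM => //.
  by apply: measurable_funB; exact: measurable_bump.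
- move=> y; rewrite normrM indicE; case: (boolP (y \in _)) => /= [_|].
    by rewrite mulr1 ler_pM// bump_lip.
  rewrite notin_setE /setU/= !ballEmdist/= => /not_orP[/negP + /negP].
  by rewrite -!leNgt => *; rewrite !bump_far// subrr normr0 mul0r mulr0.
- by rewrite !mulr_ge0// ?(M0 x)// ?invr_ge0 ?mdist_ge0 ?(ltW t0) ?(ltW L0).
Qed.

Lemma measurable_avg : measurable_fun setT (avg m N h t F).
Proof. exact: (lipschitz_borel borelX avg_lipschitz). Qed.

Lemma avg_le x : avg m N h t F x <= c * 2 `^ N * M.
Proof.
have tN0 : 0 < t `^ N by exact: powR_gt0.
rewrite /avg powRN ler_pdivrMl// (le_trans (ler_norm _))//.
have -> : t `^ N * (c * 2 `^ N * M) = M * (c * 2 `^ N * t `^ N) by ring.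
apply: (Rintegral_le_indic (measurable_mball borelX x (2 * t)) (ball_le _ _ t0) _
  (bumpM_dom x)) => //; exact: M0 x.
Qed.

(** The bump equals 1 on the ball of radius t/2, so lower Ahlfors regularity applies to that ball.
    This is what keeps [phi] and [psi] bounded. *)
Lemma avg_ge (a : R) x : 0 <= a -> (forall y, a <= F y) ->
  c^-1 * (2^-1) `^ N * a <= avg m N h t F x.
Proof.
move=> a0 aF; have tN0 : 0 < t `^ N by exact: powR_gt0.
rewrite /avg powRN ler_pdivlMl//.
pose B := ball x (t / 2).
have mB : measurable B by exact: measurable_mball.
have t20 : 0 < t / 2 by rewrite divr_gt0.
have /andP[B1 B2] := regm x t20.
have iB : m.-integrable setT (EFin \o (fun y => a * \1_B y)).
  apply: (@integrable_le_indic _ _ _ _ B _ a) => //; first exact: B2.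
    by apply: measurable_funM.
  by move=> y; rewrite ger0_norm// mulr_ge0.
apply: (@le_trans _ _ (\int[m]_y (a * \1_B y))); last first.
  apply: le_Rintegral => //; first exact: integrable_bumpM.
  move=> y _; rewrite indicE; case: (boolP (y \in _)) => /= [|_].
    rewrite inE /B ballEmdist/= => /ltW xy.
    by rewrite bump_near// mulr1 mul1r.
  by rewrite mulr0 mulr_ge0 ?bump_ge0// (le_trans a0).
rewrite -lee_fin /Rintegral fineK; last exact: integrable_fin_num.
under eq_integral do rewrite EFinM.
rewrite ge0_integralZl//; last by apply/measurable_EFinP.
rewrite integral_indic// setIT.
have -> : t `^ N * (c^-1 * 2^-1 `^ N * a) = a * (c^-1 * (t / 2) `^ N).
  by rewrite powRM ?invr_ge0 ?(ltW t0)//; ring.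
by rewrite EFinM lee_wpmul2l// lee_fin.
Qed.

End fixed_scale.

(* Stable under products, inverses and averaging, and enough for joint
   measurability; nothing is asked at nonpositive scales. *)
Definition tame (a b : R) (F : X -> R -> R) :=
  [/\ forall t, 0 < t -> measurable_fun setT (F^~ t),
      forall y t, 0 < t -> a <= F y t <= b
    & forall y t, 0 < t -> {for t, continuous (F y)}].

Lemma tame_cst (a : R) : tame a a (fun _ _ => a).
Proof. by split=> [|? ? _|? ? _]; rewrite ?lexx//; exact: cst_continuous. Qed.

Lemma tame_bump x : tame 0 1 (fun y (t : R) => bump x t y).
Proof.
split=> [t t0|y t t0|y t t0]; [exact: measurable_bump| |exact: continuous_bump].
by rewrite bump_ge0// bump_le1.
Qed.

Lemma tame_norm (a b : R) F y t : 0 <= a -> tame a b F -> 0 < t -> `|F y t| <= b.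
Proof.
move=> a0 [_ ab _] t0; have /andP[aF Fb] := ab y t t0.
by rewrite ger0_norm// (le_trans a0).
Qed.

Lemma tameM (a b a' b' : R) F G : 0 <= a -> 0 <= a' -> tame a b F -> tame a' b' G ->
  tame (a * a') (b * b') (fun y t => F y t * G y t).
Proof.
move=> a0 a'0 [mF abF cF] [mG abG cG]; split=> [t t0|y t t0|y t t0].
- by apply: measurable_funM; [exact: mF|exact: mG].
- have /andP[F1 F2] := abF y t t0; have /andP[G1 G2] := abG y t t0.
  have F0 : 0 <= F y t by exact: le_trans a0 F1.
  have G0 : 0 <= G y t by exact: le_trans a'0 G1.
  by apply/andP; split; exact: ler_pM.
- by apply: cvgM; [exact: cF|exact: cG].
Qed.

Lemma tameV (a b : R) F : 0 < a -> tame a b F -> tame b^-1 a^-1 (fun y t => 1 / F y t).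
Proof.
move=> a0 [mF abF cF].
have F0 y t : 0 < t -> 0 < F y t.
  by move=> t0; have /andP[+ _] := abF y t t0; exact: lt_le_trans.
split=> [t t0|y t t0|y t t0].
- rewrite (_ : (fun _ => _) = (fun y => (F y t) `^ (- 1))).
    exact: (measurableT_comp (measurable_powR (- 1)) (mF t t0)).
  by apply/funext => y; rewrite div1r powR_inv1// ltW// F0.
- have /andP[F1 F2] := abF y t t0.
  by rewrite div1r !lef_pV2 ?posrE ?F0 ?F1 ?F2// (lt_le_trans a0) ?(le_trans F1).
- apply: cvgMl_tmp; apply: (cvgV _ (cF y t t0)).
  by rewrite gt_eqF// F0.
Qed.

(** Measurability and bounds are those of a fixed scale. Continuity in the scale, where bump and [F]
    both move, is dominated convergence on a neighbourhood of t. *)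
Lemma tame_avg (a b : R) F : 0 <= a -> tame a b F ->
  tame (c^-1 * (2^-1) `^ N * a) (c * 2 `^ N * b)
    (fun x t => avg m N h t (F^~ t) x).
Proof.
move=> a0 tF; have [mF abF cF] := tF; split=> [t t0|x t t0|x t t0].
- apply: (measurable_avg t0 (mF t t0)) => y; exact: tame_norm tF t0.
- rewrite (@avg_ge t (F^~ t) b)//; last first.
  + by move=> y; have /andP[] := abF y t t0.
  + by move=> y; exact: tame_norm tF t0.
  + exact: mF.
  + rewrite (@avg_le t (F^~ t) b)//; first exact: mF.
    by move=> y; exact: tame_norm tF t0.
- apply: cvgM; first exact: continuous_powR.
  have tI : t \in (`]t / 2, 2 * t[%classic : set R).
    by rewrite inE/= in_itv/=; apply/andP; split; lra.
  (* For every scale s < 2t the bump at x is supported in this ball, so [b] times its indicator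
     dominates all the integrands at once. *)
  pose A := ball x (4 * t).
  have b0 : 0 <= b by have := tame_norm x a0 tF t0; apply: le_trans.
  apply: (@continuity_under_integral _ _ _ m (fun (s : R) y => bump x s y * F y s) setT
    measurableT (t / 2) (2 * t) _ _ (fun y => b * \1_A y) _ _ t tI).
  + move=> s; rewrite /= in_itv/= => /andP[s1 s2]; have s0 : 0 < s by lra.
    apply: (integrable_bumpM s0 (mF s s0)) => y; exact: tame_norm tF s0.
  + apply: aeW => y _ s; rewrite inE/= in_itv/= => /andP[s1 s2].
    have s0 : 0 < s by lra.
    by apply: cvgM; [exact: continuous_bump|exact: cF].
  + apply: (integrable_le_indic (measurable_mball borelX x (4 * t)) (ball_le _ _ t0)
      _ _ b0) => //.
    * by apply: measurable_funM => //; apply: measurable_indic; exact: measurable_mball.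
    * by move=> y; rewrite ger0_norm// mulr_ge0.
  + move=> s; rewrite /= in_itv/= => /andP[s1 s2]; have s0 : 0 < s by lra.
    apply: aeW => y _.
    rewrite normrM ger0_norm ?bump_ge0// indicE; case: (boolP (y \in _)) => /=.
      move=> _; rewrite mulr1 -[leRHS]mul1r ler_pM// ?bump_ge0// ?bump_le1//.
      exact: tame_norm tF s0.
    rewrite notin_setE /A ballEmdist/= => /negP; rewrite -leNgt => xy.
    by rewrite bump_far ?mul0r ?mulr0//; lra.
Qed.

End averages.

(** * The approximation of the identity *)

Section caratheodory.
Context (d : measure_display) (R : realType) (X : measurableType d).

(* The second variable is rounded up to a multiple of [1 / (n + 1)], which stays
   positive; the resulting functions converge by continuity. *)
Lemma caratheodory_measurable (F : X -> R -> R) :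
  (forall t, 0 < t -> measurable_fun setT (F^~ t)) ->
  (forall y t, 0 < t -> {for t, continuous (F y)}) ->
  measurable_fun (setT `*` (`]0, +oo[%classic : set R)) (fun p : X * R => F p.1 p.2).
Proof.
move=> mF cF; set D := (X in measurable_fun X).
have mD : measurable D by apply: measurableX => //; exact: measurable_itv.
pose q (n : nat) (t : R) : R := (Num.truncn (t * n.+1%:R)).+1%:R / n.+1%:R.
have qD n t : 0 < t -> t < q n t <= t + n.+1%:R^-1.
  move=> t0; have t1 : 0 <= t * n.+1%:R by rewrite mulr_ge0// ltW.
  have /andP[t2 t3] := truncn_itv t1.
  rewrite /q ltr_pdivlMr// t3/= ler_pdivrMr// mulrDl mulVf// -natr1.
  by rewrite lerD2r.
apply: (@measurable_fun_cvg _ _ _ D (fun n p => F p.1 (q n p.2))); last first.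
  move=> [y t] [_ /=]; rewrite in_itv/= andbT => t0.
  apply: (cvg_comp (fun n => q n t) (F y) _ (cF y t t0)).
  apply: (@squeeze_cvgr _ _ _ _ (fun=> t) (fun n => t + n.+1%:R^-1)).
  - by apply: nearW => n; have /andP[/ltW -> ->] := qD n t t0.
  - exact: cvg_cst.
  - rewrite -[X in _ --> X]addr0; apply: cvgD; first exact: cvg_cst.
    exact: cvg_harmonic.
move=> n _ B mB; pose G k : set X := F^~ (k.+1%:R / n.+1%:R) @^-1` B.
pose I (k : nat) : set R :=
  `[k%:R / n.+1%:R, k.+1%:R / n.+1%:R[ `&` `]0, +oo[.
(* On [I k] the rounded scale is the constant [(k + 1) / (n + 1)], so the preimage is a countable
   union of measurable rectangles. *)
rewrite (_ : _ `&` _ = \bigcup_k (G k `*` I k)).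
  apply: bigcup_measurable => k _; apply: measurableX.
    rewrite -[G k]setTI; apply: mF => //; exact: divr_gt0.
  by apply: measurableI; exact: measurable_itv.
apply/seteqP; split=> [[y t] [[_ /= t0] BF]|[y t] [k _ [/= Gk [tk t0]]]].
  exists (Num.truncn (t * n.+1%:R)) => //; split => //=; split => //=.
  move: t0; rewrite !in_itv/= andbT => t0.
  have t1 : 0 <= t * n.+1%:R by rewrite mulr_ge0// ltW.
  have /andP[t2 t3] := truncn_itv t1.
  by rewrite ler_pdivrMr// t2 ltr_pdivlMr.
split => //=; rewrite /q.
move: tk; rewrite /= in_itv/= ler_pdivrMr// ltr_pdivlMr// => tk.
have -> : Num.truncn (t * n.+1%:R) = k by exact/truncn_def.
exact: Gk.
Qed.

End caratheodory.

Section approximation_of_identity.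
Context (d : measure_display) (R : realType) (X : measurableMetricType d R).
Variables (m : {measure set X -> \bar R}) (N : R) (h : R -> R) (c L : R).
Hypotheses (borelX : borel_sigma_algebra X) (c0 : 0 < c) (L0 : 0 < L).
Hypothesis regm : forall (x : X) (r : R), 0 < r ->
  ((c^-1 * r `^ N)%:E <= m (ball x r) <= (c * r `^ N)%:E)%E.
Hypothesis hcut : cutoff h.
Hypothesis lip_h :
  forall a b : R, 0 <= a -> 0 <= b -> `|h a - h b| <= L * `|a - b|.

Local Notation bump x t y := (h (mdist x y / t)).
Local Notation avg := (avg m N h).
Local Notation phi := (phi m N h).
Local Notation psi := (psi m N h).
Local Notation s := (approx_id m N h).

(** [v] and [V] are the lower and upper bounds of T_t 1 given by [tame_avg] at a = b = 1; the bounds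
    of [phi], [psi] and [profile] are built from them. *)
Let v : R := c^-1 * (2^-1) `^ N.
Let V : R := c * 2 `^ N.

Let v0 : 0 < v. Proof. by rewrite mulr_gt0 ?invr_gt0// powR_gt0. Qed.
Let V0 : 0 < V. Proof. by rewrite mulr_gt0// powR_gt0. Qed.

Let tame_avg' := tame_avg borelX L0 regm hcut lip_h.

Lemma tame_phi : tame V^-1 v^-1 phi.
Proof.
have := tame_avg' ler01 (tame_cst X 1); rewrite !mulr1 => tA.
exact: tameV tA.
Qed.

Lemma tame_psi : tame (V * v^-1)^-1 (v * V^-1)^-1 psi.
Proof.
have Vi0 : 0 <= V^-1 by rewrite invr_ge0 ltW.
have tA := tame_avg' Vi0 tame_phi.
by apply: tameV tA; rewrite mulr_gt0 ?invr_gt0.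
Qed.

(** For t > 0 this is [t^N] times [s]: the integral over w is read as an average centred at [z],
    which absorbs one of the two factors [t^-N]. Tameness then follows from [tame_avg], with bounds
    free of t. *)
Definition profile (x z : X) (t : R) : R :=
  phi x t * phi z t * avg t (fun w => bump x t w * psi w t) z.

Lemma approx_idE x z t : 0 < t -> s x z t = t `^ (- N) * profile x z t.
Proof.
move=> t0; rewrite /approx_id /profile /Defs.avg.
rewrite (@eq_Rintegral _ _ _ m _ (fun w => bump z t w * (bump x t w * psi w t))); last first.
  by move=> w _; rewrite mulrA [bump z t w * _]mulrC.
have -> : 2 * N = N + N by rewrite mulr_natl mulr2n.
rewrite powRD; last by rewrite (gt_eqF t0) implybT.
by rewrite invfM powRN; ring.
Qed.

(** The two bumps enter symmetrically, so x can be made the centre of the average; the dependence on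
    x is then controlled by [avg_lipschitz]. *)
Lemma avg_swap x z t (F : X -> R) :
  avg t (fun w => bump x t w * F w) z = avg t (fun w => bump z t w * F w) x.
Proof.
by congr (_ * _); apply: eq_Rintegral => w _; rewrite mulrCA.
Qed.

(** Every w is at distance at least 2t from x or from z, so one of the two bumps vanishes there. *)
Lemma profile_far x z t : 0 < t -> 4 * t <= mdist x z -> profile x z t = 0.
Proof.
move=> t0 xz; rewrite /profile /Defs.avg.
under eq_Rintegral.
  move=> w _; rewrite (_ : _ * _ = 0); first over.
  have := metric_triangle x w z; rewrite (metric_sym w z) => tri.
  have [xw|/ltW xw] := lerP (2 * t) (mdist x w).
    by rewrite (bump_far hcut t0 xw) mul0r mulr0.
  by rewrite (bump_far (y := w) hcut t0) ?mul0r//; lra.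
by rewrite /Rintegral integral0 /= !mulr0.
Qed.

Let W : R := (v * V^-1)^-1.

(** Turns the factor [phi x t], with x frozen, into a tame function of z, as [tameM] expects. *)
Lemma tame_at (a b : R) (F : X -> R -> R) x :
  tame a b F -> tame a b (fun _ : X => F x).
Proof.
by move=> [mF abF cF]; split=> [t t0|y t t0|y t t0]; [|exact: abF|exact: cF].
Qed.

Lemma tame_cross x : tame 0 W (fun w t => bump x t w * psi w t).
Proof.
have := tameM (lexx 0) _ (tame_bump borelX L0 hcut lip_h x) tame_psi.
by rewrite mul0r mul1r; apply; rewrite invr_ge0 mulr_ge0 ?invr_ge0 ?ltW.
Qed.

Lemma tame_profile x : tame 0 (v^-1 * v^-1 * (V * W)) (profile x).
Proof.
have Vi0 : 0 <= V^-1 by rewrite invr_ge0 ltW.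
have tA := tame_avg' (lexx 0) (tame_cross x).
have tP := tameM Vi0 Vi0 (tame_at x tame_phi) tame_phi.
have VV0 : 0 <= V^-1 * V^-1 by rewrite mulr_ge0.
have := tameM VV0 _ tP tA.
by rewrite !mulr0; apply.
Qed.

Lemma profile_lip x y z t : 0 < t -> `|profile x z t - profile y z t| <=
  (v^-1 * v^-1 * v^-1 * (V * W) + v^-1 * v^-1 * W) * (2 * V * L) * (mdist x y / t).
Proof.
move=> t0.
have vi0 : 0 <= v^-1 by rewrite invr_ge0 ltW.
have W0 : 0 <= W by rewrite invr_ge0 mulr_ge0 ?invr_ge0 ?ltW.
have Vi0 : 0 <= V^-1 by rewrite invr_ge0 ltW.
have phib w : 0 < phi w t <= v^-1.
  have [_ /(_ w t t0)/andP[+ ->] _] := tame_phi; rewrite andbT.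
  by apply: lt_le_trans; rewrite invr_gt0.
(* The bound of [avg_lipschitz] for a function of size 1. It serves for T_t 1 as it stands, and for
   the average of bump times [psi] after multiplication by [W]. *)
set K := 2 * V * L * (mdist x y / t).
have K0 : 0 <= K.
  by rewrite !mulr_ge0// ?invr_ge0 ?mdist_ge0// ltW.
pose A w := avg t (fun=> 1) w.
have phiA w : phi w t = 1 / A w by [].
have A0 w : A w != 0.
  have /andP[] := phib w; rewrite phiA div1r invr_gt0 => Aw _.
  by rewrite gt_eqF.
have dA : `|A x - A y| <= K.
  have := @avg_lipschitz _ _ _ m N h c L borelX L0 regm hcut lip_h t
    (fun=> 1) 1 t0 (measurable_cst _) _ x y.
  rewrite mulr1 (_ : _ * L / t * _ = K); last by rewrite /K /V; ring.
  by apply => _; rewrite normr1.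
have dphi : `|phi x t - phi y t| <= v^-1 * v^-1 * K.
  rewrite (_ : _ - _ = phi x t * phi y t * (A y - A x)); last first.
    by rewrite !phiA; field; rewrite !A0.
  have /andP[px0 px] := phib x; have /andP[py0 py] := phib y.
  rewrite normrM distrC normrM (gtr0_norm px0) (gtr0_norm py0).
  have := ltW px0; have := ltW py0 => py0' px0'.
  by apply: ler_pM => //; [exact: mulr_ge0|exact: ler_pM].
pose Q w := avg t (fun w => bump z t w * psi w t) w.
have QE w : avg t (fun u => bump w t u * psi u t) z = Q w by exact: avg_swap.
have dQ : `|Q x - Q y| <= K * W.
  have tz := tame_cross z; have [mz _ _] := tz.
  have := @avg_lipschitz _ _ _ m N h c L borelX L0 regm hcut lip_h t
    (fun w => bump z t w * psi w t) W t0 (mz t t0) _ x y.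
  rewrite (_ : _ * L * W / t * _ = K * W); last by rewrite /K /V; ring.
  by apply => w; exact: tame_norm tz t0.
have Qb : 0 <= Q x <= V * W.
  have [_ /(_ x t t0) + _] := tame_avg' (lexx 0) (tame_cross z).
  by rewrite mulr0.
rewrite /profile !QE.
have /andP[px0 px] := phib x; have /andP[py0 py] := phib y.
have /andP[pz0 pz] := phib z; have /andP[Q0 QV] := Qb.
(* Telescoping changes one factor depending on x at a time; the two summands of the constant bound
   the two terms. *)
rewrite (_ : _ - _ = (phi x t - phi y t) * phi z t * Q x +
   phi y t * phi z t * (Q x - Q y)); last by ring.
apply: (le_trans (ler_normD _ _)).
rewrite (_ : _ * (mdist x y / t) = v^-1 * v^-1 * K * v^-1 * (V * W) +
   v^-1 * v^-1 * (K * W)); last by rewrite /K; ring.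
apply: lerD.
- rewrite 2!normrM (gtr0_norm pz0) (ger0_norm Q0).
  apply: ler_pM => //; first by rewrite mulr_ge0// ltW.
  by apply: ler_pM => //; exact: ltW.
- rewrite normrM normrM (gtr0_norm py0) (gtr0_norm pz0).
  have := ltW py0; have := ltW pz0 => pz0' py0'.
  by apply: ler_pM => //; [exact: mulr_ge0|exact: ler_pM].
Qed.

Lemma approx_id_estimates : exists2 B, 0 < B &
  [/\ forall x z t, 0 < t -> 0 <= s x z t <= B * t `^ (- N),
      forall x z t, 0 < t -> 4 * t <= mdist x z -> s x z t = 0,
      forall x y z t, 0 < t ->
        `|s x z t - s y z t| <= B * t `^ (- N) * (mdist x y / t)
    & forall x, measurable_fun (setT `*` (`]0, +oo[%classic : set R))
        (fun p : X * R => s x p.1 p.2)].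
Proof.
set B1 := v^-1 * v^-1 * (V * W).
set B2 := (v^-1 * v^-1 * v^-1 * (V * W) + v^-1 * v^-1 * W) * (2 * V * L).
(* One constant serves the size bound [B1] and the Lipschitz bound [B2]; absolute values and the
   added 1 make it positive without a look at the signs. *)
exists (`|B1| + `|B2| + 1); first by rewrite ltr_wpDl// addr_ge0.
split=> [x z t t0|x z t t0 xz|x y z t t0|x].
- have [_ /(_ z t t0)/andP[p0 pB] _] := tame_profile x.
  rewrite approx_idE// mulr_ge0 ?powR_ge0//= mulrC ler_wpM2r ?powR_ge0//.
  by apply: (le_trans pB); rewrite -addrA (le_trans (ler_norm _))// lerDl addr_ge0.
- by rewrite approx_idE// profile_far// mulr0.
- rewrite !approx_idE// -mulrBr normrM ger0_norm ?powR_ge0//.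
  rewrite mulrAC mulrC ler_wpM2r ?powR_ge0//.
  apply: (le_trans (profile_lip _ _ _ t0)); rewrite -/B2.
  rewrite ler_wpM2r ?divr_ge0 ?mdist_ge0 ?(ltW t0)// (le_trans (ler_norm _))//.
  by rewrite addrAC lerDr addr_ge0.
- have [mp _ cp] := tame_profile x.
  apply: (eq_measurable_fun (fun p : X * R => p.2 `^ (- N) * profile x p.1 p.2)).
    move=> [z t]; rewrite inE/= in_itv/= andbT => -[_ t0].
    by rewrite approx_idE.
  apply: measurable_funM; last exact: caratheodory_measurable.
  apply: measurable_funTS.
  exact: (measurableT_comp (measurable_powR (- N)) measurable_snd).
Qed.

End approximation_of_identity.

(** * The weight of the Bessel kernel *)

Lemma measurable_min_div (R : realType) (r : R) :
  measurable_fun (`]0, +oo[%classic : set R) (fun t => Num.min 1 (r / t)).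
Proof.
apply: measurable_minr => //; apply: measurable_funM => //.
apply: (eq_measurable_fun (fun t : R => t `^ (- 1))).
  by move=> t; rewrite inE/= in_itv/= andbT => t0; rewrite powR_inv1 ?ltW.
by apply: measurable_funTS; exact: measurable_powR.
Qed.

Section bessel_weight.
Context (R : realType) (alpha : R).
Hypothesis alpha0 : 0 < alpha.
Local Notation leb := (@lebesgue_measure R).

(** The weight of the kernel against [s dt / t]. With u = t^alpha and t > 0 it is u / (1 + u)^2,
    which is invariant under t -> 1/t and lies below both u and 1/u. *)
Definition bessel_weight (t : R) : R := t `^ alpha / (1 + t `^ alpha) ^+ 2.
Local Notation w := bessel_weight.

Lemma bessel_weight_ge0 t : 0 <= w t.
Proof. by rewrite divr_ge0 ?exprn_ge0 ?addr_ge0 ?powR_ge0. Qed.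

Lemma bessel_weight_le t : w t <= t `^ alpha.
Proof.
have u0 := powR_ge0 t alpha; rewrite /w ler_pdivrMr ?exprn_gt0 ?ltr_wpDr//.
by rewrite ler_peMr// exprn_ege1// lerDl.
Qed.

Lemma bessel_weight_le_inv t : 0 < t -> w t <= t `^ (- alpha).
Proof.
move=> t0; have u0 := powR_gt0 alpha t0.
rewrite powRN /w ler_pdivrMr ?exprn_gt0 ?ltr_wpDr ?(ltW u0)// ler_pdivlMl//.
by rewrite -expr2 lerXn2r ?nnegrE ?addr_ge0 ?(ltW u0)// lerDr.
Qed.

(** For t <= 1 the weight is at most [t^alpha <= t^beta]; for t > 1 it is at most
    [t^-alpha <= 1 <= t^beta]. *)
Lemma bessel_weight_le_powR beta t : 0 < beta -> beta <= alpha -> 0 < t ->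
  w t <= t `^ beta.
Proof.
move=> b0 ba t0; have [t1|/ltW t1] := lerP t 1.
  by apply: (le_trans (bessel_weight_le t)); rewrite ger_powR// t0.
apply: (le_trans (bessel_weight_le_inv t0)).
rewrite (@le_trans _ _ (t `^ 0))// ler_powR//; first by rewrite oppr_le0 ltW.
exact: ltW.
Qed.

Lemma measurable_bessel_weight :
  measurable_fun (`]0, +oo[%classic : set R) (fun t : R => w t / t).
Proof.
apply: (eq_measurable_fun
  (fun t : R => t `^ alpha * (1 + t `^ alpha) `^ (- 2%:R) * t `^ (- 1))).
  move=> t; rewrite inE/= in_itv/= andbT => t0.
  by rewrite powR_invn ?addr_ge0 ?powR_ge0// powR_inv1 ?ltW.
apply: measurable_funTS; apply: measurable_funM; last exact: measurable_powR.
apply: measurable_funM; first exact: measurable_powR.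
apply: (measurableT_comp (measurable_powR (- 2%:R))).
by apply: measurable_funD => //; exact: measurable_powR.
Qed.

(** Both weight integrals below are estimated by cutting the half line at r, with a different power
    as majorant on each side. The second interval is closed at r to fit [integral_powR_infty]. *)
Lemma integral_halfline_split (f g1 g2 : R -> R) (r : R) : 0 < r ->
  (forall t, 0 < t -> 0 <= f t) -> measurable_fun (`]0, +oo[%classic : set R) f ->
  measurable_fun setT g1 -> measurable_fun setT g2 ->
  (forall t, 0 < t -> t <= r -> f t <= g1 t) ->
  (forall t, r <= t -> f t <= g2 t) ->
  (\int[leb]_(t in `]0%R, +oo[) (f t)%:E <=
   \int[leb]_(t in `]0%R, r]) (g1 t)%:E + \int[leb]_(t in `[r, +oo[) (g2 t)%:E)%E.
Proof.
move=> r0 f0 mf mg1 mg2 fg1 fg2.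
have sub1 : `]0, r]%classic `<=` (`]0, +oo[%classic : set R).
  by move=> t /=; rewrite !in_itv/= andbT => /andP[].
have sub2 : `]r, +oo[%classic `<=` (`]0, +oo[%classic : set R).
  by move=> t /=; rewrite !in_itv/= !andbT; exact: lt_trans.
have -> : (`]0, +oo[%classic : set R) = `]0, r] `|` `]r, +oo[.
  apply/seteqP; split=> t; last by case; [exact: sub1|exact: sub2].
  rewrite /= !in_itv/= !andbT => t0.
  by rewrite t0; case: (leP t r) => _; [left|right].
rewrite ge0_integral_setU//=; first last.
- rewrite disj_set2E; apply/eqP/seteqP; split => // t [] /=.
  by rewrite !in_itv/= andbT => /andP[_ tr] /lt_geF; rewrite tr.
- move=> t [/sub1|/sub2]; rewrite /= in_itv/= andbT => t0;
  by rewrite lee_fin f0.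
- apply/measurable_EFinP; apply: measurable_funS mf => // t.
  by case; [exact: sub1|exact: sub2].
apply: leeD.
- apply: ge0_le_integral => //=.
  + by move=> t /sub1; rewrite /= in_itv/= andbT => t0; rewrite lee_fin f0.
  + by apply/measurable_EFinP; exact: measurable_funS mf.
  + by apply/measurable_EFinP; exact: measurable_funTS.
  + by move=> t; rewrite in_itv/= => /andP[t0 tr]; rewrite lee_fin fg1.
- apply: (@le_trans _ _ (\int[leb]_(t in `]r, +oo[) (g2 t)%:E)%E).
    apply: ge0_le_integral => //=.
    + by move=> t /sub2; rewrite /= in_itv/= andbT => t0; rewrite lee_fin f0.
    + by apply/measurable_EFinP; exact: measurable_funS mf.
    + by apply/measurable_EFinP; exact: measurable_funTS.
    + by move=> t; rewrite in_itv/= andbT => /ltW rt; rewrite lee_fin fg2.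
  apply: ge0_subset_integral => //=.
  + by apply/measurable_EFinP; exact: measurable_funTS.
  + move=> t; rewrite in_itv/= andbT => rt; rewrite lee_fin.
    by apply: le_trans (fg2 _ rt); apply: f0; exact: lt_le_trans rt.
  + by move=> t /=; rewrite !in_itv/= !andbT; exact: ltW.
Qed.

(** Cut at 1, with majorants [t^(alpha - 1)] and [t^(- alpha - 1)], each contributing [1 / alpha].
    The factor alpha in front of the kernel later cancels this. *)
Lemma bessel_weight_integral :
  (\int[leb]_(t in `]0%R, +oo[) (w t / t)%:E <= (2 / alpha)%:E)%E.
Proof.
have wt0 t : 0 < t -> 0 <= w t / t.
  by move=> t0; rewrite divr_ge0 ?bessel_weight_ge0// ltW.
apply: (le_trans (integral_halfline_split ltr01 wt0 measurable_bessel_weight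
  (measurable_powR (alpha - 1)) (measurable_powR (- alpha - 1)) _ _)).
- move=> t t0 _; rewrite -(@ler_pM2r _ t)// divfK ?gt_eqF//.
  by rewrite mulrC mulr_powRB1 ?(ltW t0)//; exact: bessel_weight_le.
- move=> t t1; have t0 : 0 < t by exact: lt_le_trans t1.
  rewrite powRB ?(gt_eqF t0) ?implybT// powRr1 ?(ltW t0)//.
  by rewrite ler_wpM2r ?invr_ge0 ?(ltW t0)//; exact: bessel_weight_le_inv.
rewrite integral_powR_infty// (le_trans (leeD2r _ (integral_powR_near0 _ _)))//.
by rewrite -EFinD lee_fin !powR1 -mulrDl.
Qed.

(** Cut at r, where the minimum changes branch. Below, [t^(beta - 1)] gives [r^beta / beta]; above,
    [r t^(beta - 2)] gives [r^beta / (1 - beta)], convergent because beta < 1. *)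
Lemma bessel_weight_integral_min (beta r : R) :
  0 < beta < 1 -> beta <= alpha -> 0 < r ->
  (\int[leb]_(t in `]0%R, +oo[) (w t / t * Num.min 1 (r / t))%:E <=
   ((beta^-1 + (1 - beta)^-1) * r `^ beta)%:E)%E.
Proof.
move=> /andP[b0 b1] ba r0.
have wt t : 0 < t -> w t / t <= t `^ (beta - 1).
  move=> t0; rewrite -(@ler_pM2r _ t)// divfK ?gt_eqF//.
  by rewrite mulrC mulr_powRB1 ?(ltW t0)//; exact: bessel_weight_le_powR.
have wt0 t : 0 < t -> 0 <= w t / t.
  by move=> t0; rewrite divr_ge0 ?bessel_weight_ge0// ltW.
have c0 : 0 < 1 - beta by rewrite subr_gt0.
have m0 t : 0 < t -> 0 <= Num.min 1 (r / t).
  by move=> t0; rewrite le_min ler01 divr_ge0// ltW.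
apply: (le_trans (@integral_halfline_split _ (fun t => t `^ (beta - 1))
  (fun t => r * t `^ (- (1 - beta) - 1)) r r0 _ _ _ _ _ _)).
- by move=> t t0; rewrite mulr_ge0 ?wt0 ?m0.
- apply: measurable_funM; first exact: measurable_bessel_weight.
  exact: measurable_min_div.
- exact: measurable_powR.
- by apply: measurable_funM => //; exact: measurable_powR.
- move=> t t0 _; apply: le_trans (wt t t0).
  by rewrite ler_piMr ?wt0// ge_min lexx.
- move=> t rt; have t0 : 0 < t by exact: lt_le_trans rt.
  have -> : r * t `^ (- (1 - beta) - 1) = t `^ (beta - 1) * (r / t).
    have -> : - (1 - beta) - 1 = (beta - 1) - 1 by ring.
    rewrite powRB ?(gt_eqF t0) ?implybT// powRr1 ?(ltW t0)//.
    by rewrite mulrCA.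
  apply: ler_pM; rewrite ?wt0 ?m0 ?wt//.
  by rewrite ge_min lexx orbT.
under [X in (_ + X <= _)%E]eq_integral do rewrite EFinM.
rewrite ge0_integralZl//=; first last.
- by rewrite lee_fin ltW.
- by move=> t _; rewrite lee_fin powR_ge0.
- by apply/measurable_EFinP; apply: measurable_funTS; exact: measurable_powR.
rewrite integral_powR_infty// (le_trans (leeD2r _ (integral_powR_near0 _ _)))//.
rewrite -EFinM -EFinD lee_fin.
have -> : r * (r `^ (- (1 - beta)) / (1 - beta)) = r `^ beta / (1 - beta).
  rewrite mulrA; congr (_ / _); rewrite opprB.
  by rewrite mulr_powRB1 ?(ltW r0).
by rewrite mulrDl [_ / beta]mulrC [_ / (1 - beta)]mulrC.
Qed.

End bessel_weight.

(** * Tonelli on the half line *)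

Section tonelli_halfline.
Context (d : measure_display) (R : realType) (X : measurableType d).
Variable m : {measure set X -> \bar R}.
Hypothesis sm : sigma_finite setT m.
Local Notation leb := (@lebesgue_measure R).
Variable H : X * R -> R.
Hypothesis mH : measurable_fun (setT `*` (`]0, +oo[%classic : set R)) H.
Hypothesis H0 : forall z t, 0 < t -> 0 <= H (z, t).

Let D : set (X * measurableTypeR R) := setT `*` `]0, +oo[%classic.

(** Extension of [H] by zero to all scales, so that Tonelli runs on the full product; [H] is
    controlled at positive scales only. *)
Let f : X * measurableTypeR R -> \bar R := (EFin \o H) \_ D.

Let mD : measurable D.
Proof. by apply: measurableX => //; exact: measurable_itv. Qed.

Let mf : measurable_fun setT f.
Proof.
apply/(measurable_restrictT (EFin \o H) mD).
by apply/measurable_EFinP.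
Qed.

Let f0 p : (0 <= f p)%E.
Proof.
rewrite /f patchE; case: ifPn => //; case: p => z t.
rewrite inE /D/= in_itv/= andbT => -[_ t0].
by rewrite lee_fin H0.
Qed.

Let fE z : (\int[leb]_t f (z, t) = \int[leb]_(t in `]0%R, +oo[) (H (z, t))%:E)%E.
Proof.
rewrite [RHS]integral_mkcond; apply: eq_integral => t _.
rewrite /f !patchE; congr (if _ then _ else _).
by apply/idP/idP; rewrite !inE /D/= !in_itv/=; [case|split].
Qed.

Let gE t : (0 < t)%R -> (\int[m]_z f (z, t) = \int[m]_z (H (z, t))%:E)%E.
Proof.
move=> t0; apply: eq_integral => z _.
by rewrite /f patchE mem_set// /D/= in_itv/= t0.
Qed.

Lemma measurable_integral_halfline : measurable_fun setT
  (fun z => \int[leb]_(t in `]0%R, +oo[) (H (z, t))%:E)%E.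
Proof.
rewrite -(funext fE).
exact: (@measurable_fun_fubini_tonelli_F _ _ X (measurableTypeR R) R leb f mf f0).
Qed.

(** The measure [m] again, with its sigma-finiteness bundled into the type. *)
Let m' : {sigma_finite_measure set X -> \bar R} :=
  HB.pack_for (SigmaFiniteMeasure.type X R) (Measure.sort m)
    (@isSFinite.Build _ X R (Measure.sort m) (sfinite_measure_sigma_finite sm))
    (@isSigmaFinite.Build _ X R (Measure.sort m) sm).

Lemma measurable_integral_slice :
  measurable_fun (`]0, +oo[%classic : set R) (fun t => \int[m]_z (H (z, t))%:E)%E.
Proof.
apply: (eq_measurable_fun (fun t => \int[m]_z f (z, t))%E).
  by move=> t; rewrite inE/= in_itv/= andbT => t0; rewrite gE.
apply: measurable_funTS.
exact: (@measurable_fun_fubini_tonelli_G _ _ X (measurableTypeR R) R m' f mf f0).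
Qed.

Lemma tonelli_halfline :
  (\int[m]_z \int[leb]_(t in `]0%R, +oo[) (H (z, t))%:E =
   \int[leb]_(t in `]0%R, +oo[) \int[m]_z (H (z, t))%:E)%E.
Proof.
rewrite -(eq_integral _ _ (fun z _ => fE z)).
rewrite (@fubini_tonelli _ _ X (measurableTypeR R) R m' leb f mf f0).
rewrite [RHS]integral_mkcond; apply: eq_integral => t _ /=.
rewrite patchE; case: ifPn => [|t0].
  by rewrite inE/= in_itv/= andbT => t0; rewrite gE.
rewrite integral0_eq// => z _; rewrite /f patchE ifF//.
apply/negbTE; apply: contra t0; rewrite !inE /D/=; by case.
Qed.

End tonelli_halfline.

(** * The Bessel kernel and potential *)

Lemma ahlfors_sigma_finite (d : measure_display) (R : realType)
    (X : measurableMetricType d R) (m : {measure set X -> \bar R}) (N : R) (x : X) :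
  borel_sigma_algebra X -> ahlfors_regular m N -> sigma_finite setT m.
Proof.
move=> bX [c _ regm]; exists (fun n => ball x n.+1%:R).
  apply/seteqP; split=> // y _; exists (Num.truncn (mdist x y)) => //.
  by rewrite ballEmdist/=; exact: truncnS_gt.
move=> n; split; first exact: measurable_mball.
by have /andP[_ mb] := regm x n.+1%:R (ltr0Sn _ _); exact: le_lt_trans mb (ltry _).
Qed.

Lemma abse_scaleB (R : realType) (a b : R) (u v : \bar R) : 0 <= a ->
  u \is a fin_num -> v \is a fin_num ->
  (`|b%:E * (a%:E * u) - b%:E * (a%:E * v)| = (`|b| * a)%:E * `|u - v|)%E.
Proof.
move=> a0; case: u => [u| |]//; case: v => [v| |]// _ _.
by rewrite -!EFinM -!EFinB -!mulrBr !abse_EFin !normrM (ger0_norm a0) mulrA.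
Qed.

Section bessel_kernel_estimates.
Context (d : measure_display) (R : realType) (X : measurableMetricType d R).
Variables (m : {measure set X -> \bar R}) (N : R) (h : R -> R) (c B alpha : R).
Hypotheses (borelX : borel_sigma_algebra X) (c0 : 0 < c) (B0 : 0 < B).
Hypothesis sm : sigma_finite setT m.
Hypothesis regm : forall (x : X) (r : R), 0 < r ->
  ((c^-1 * r `^ N)%:E <= m (ball x r) <= (c * r `^ N)%:E)%E.
Local Notation s := (approx_id m N h).
Local Notation leb := (@lebesgue_measure R).
Local Notation w := (bessel_weight alpha).
Hypothesis s_bound : forall x z t, 0 < t -> 0 <= s x z t <= B * t `^ (- N).
Hypothesis s_far : forall x z t, 0 < t -> 4 * t <= mdist x z -> s x z t = 0.
Hypothesis s_lip : forall x y z t, 0 < t ->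
  `|s x z t - s y z t| <= B * t `^ (- N) * (mdist x y / t).
Hypothesis s_meas : forall x, measurable_fun (setT `*` (`]0, +oo[%classic : set R))
  (fun p : X * R => s x p.1 p.2).
Hypothesis alpha0 : 0 < alpha.

(** [A t^N] bounds the measure of a ball of radius 4t, outside which [s x z t] vanishes; the power
    of t cancels that in the bound [B t^-N]. *)
Let A : R := c * 4 `^ N.
Let A0 : 0 < A. Proof. by rewrite mulr_gt0// powR_gt0. Qed.

Lemma measurable_slice (G : X * R -> R) t : 0 < t ->
  measurable_fun (setT `*` (`]0, +oo[%classic : set R)) G ->
  measurable_fun setT (fun z => G (z, t)).
Proof.
move=> t0 mG; apply: (@measurable_comp _ _ _ _ _ _
    (setT `*` (`]0, +oo[%classic : set R)) G setT (fun z => (z, t))) => //.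
- by apply: measurableX => //; exact: measurable_itv.
- by move=> _ [z _ <-] /=; rewrite in_itv/= t0.
Qed.

Lemma integral_approx_id x t : 0 < t ->
  (\int[m]_z (s x z t)%:E <= (B * A)%:E)%E.
Proof.
move=> t0; have tN : 0 < t `^ N by exact: powR_gt0.
have -> : B * A = B * t `^ (- N) * (c * 4 `^ N * t `^ N).
  by rewrite powRN /A; field; rewrite gt_eqF.
rewrite (eq_integral (fun z => (`|s x z t|)%:E)); last first.
  by move=> z _; rewrite ger0_norm//; have /andP[] := s_bound x z t0.
apply: (@ge0_integral_le_indic _ _ _ _ (ball x (4 * t))).
- exact: measurable_mball.
- exact: ball_le.
- exact: measurable_slice (fun p => s x p.1 p.2) t t0 (s_meas x).
- move=> z; have /andP[s0 sB] := s_bound x z t0.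
  rewrite ger0_norm// indicE; case: (boolP (z \in _)) => /= [_|].
    by rewrite mulr1.
  rewrite notin_setE ballEmdist/= => /negP; rewrite -leNgt => xz.
  by rewrite s_far// mulr0.
- by rewrite mulr_ge0 ?powR_ge0 ?(ltW B0).
Qed.

Lemma integral_approx_id_sub x y t : 0 < t ->
  (\int[m]_z (`|s x z t - s y z t|)%:E <=
   (2 * (B * A) * Num.min 1 (mdist x y / t))%:E)%E.
Proof.
move=> t0; have tN : 0 < t `^ N by exact: powR_gt0.
set mu := Num.min _ _.
have mu0 : 0 <= mu by rewrite le_min ler01 divr_ge0 ?mdist_ge0 ?(ltW t0).
have -> : 2 * (B * A) * mu = B * t `^ (- N) * mu * (2 * (c * 4 `^ N) * t `^ N).
  by rewrite powRN /A; field; rewrite gt_eqF.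
apply: (@ge0_integral_le_indic _ _ _ _ (ball x (4 * t) `|` ball y (4 * t))).
- by apply: measurableU; exact: measurable_mball.
- exact: ball2_le.
- apply: measurable_funB.
  + exact: measurable_slice (fun p => s x p.1 p.2) t t0 (s_meas x).
  + exact: measurable_slice (fun p => s y p.1 p.2) t t0 (s_meas y).
- move=> z; have /andP[sx0 sxB] := s_bound x z t0.
  have /andP[sy0 syB] := s_bound y z t0.
  rewrite indicE; case: (boolP (z \in _)) => /= [_|].
    (* Both values lie in [[0, B t^-N]], so their difference is at most [B t^-N] without a factor 2.
       The 2 in the statement counts the two balls. *)
    rewrite mulr1 /mu minr_pMr ?mulr_ge0 ?powR_ge0 ?(ltW B0)// mulr1.
    rewrite le_min s_lip// andbT ler_norml; apply/andP; split; lra.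
  rewrite notin_setE /setU/= !ballEmdist/= => /not_orP[/negP + /negP].
  by rewrite -!leNgt => *; rewrite !s_far// subrr normr0 mulr0.
- by rewrite !mulr_ge0// ?powR_ge0 ?(ltW B0).
Qed.

Lemma measurable_weighted (G : X * R -> R) :
  measurable_fun (setT `*` (`]0, +oo[%classic : set R)) G ->
  measurable_fun (setT `*` (`]0, +oo[%classic : set R))
    (fun p => w p.2 / p.2 * G p).
Proof.
move=> mG; apply: measurable_funM => //.
apply: (@measurable_comp _ _ _ _ _ _ (`]0, +oo[%classic : set R)
  (fun t => w t / t) _ snd) => //.
- by move=> _ [[z t] [_ /= t0] <-].
- exact: measurable_bessel_weight.
- by apply: measurable_funTS; exact: measurable_snd.
Qed.

(** Used twice: with [k = 1] for the mass of the kernel and with [k = min(1, d(x, y) / t)] for the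
    difference of two kernels. Once the integrals are exchanged, only the bound on each slice in z
    matters. *)
Lemma weighted_tonelli_le (G : X * R -> R) (C : R) (k : R -> R) :
  measurable_fun (setT `*` (`]0, +oo[%classic : set R)) G ->
  measurable_fun (`]0, +oo[%classic : set R) k ->
  (forall z t, 0 < t -> 0 <= G (z, t)) -> 0 <= C ->
  (forall t, 0 < t -> 0 <= k t) ->
  (forall t, 0 < t -> (\int[m]_z (G (z, t))%:E <= (C * k t)%:E)%E) ->
  (\int[m]_z \int[leb]_(t in `]0%R, +oo[) (w t / t * G (z, t))%:E <=
   C%:E * \int[leb]_(t in `]0%R, +oo[) (w t / t * k t)%:E)%E.
Proof.
move=> mG mk G0 C0 k0 GC.
have wt0 t : 0 < t -> 0 <= w t / t.
  by move=> t0; rewrite divr_ge0 ?bessel_weight_ge0// ltW.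
have H0 z t : 0 < t -> 0 <= w t / t * G (z, t).
  by move=> t0; rewrite mulr_ge0 ?wt0 ?G0.
have mH := measurable_weighted mG.
have mwk : measurable_fun (`]0, +oo[%classic : set R) (fun t => w t / t * k t).
  by apply: measurable_funM => //; exact: measurable_bessel_weight.
rewrite (tonelli_halfline sm mH H0) -ge0_integralZl//=; first last.
- by move=> t; rewrite in_itv/= andbT => t0; rewrite lee_fin mulr_ge0 ?wt0 ?k0.
- exact/measurable_EFinP.
apply: ge0_le_integral => //=.
- move=> t; rewrite in_itv/= andbT => t0; apply: integral_ge0 => z _.
  by rewrite lee_fin H0.
- exact: (measurable_integral_slice sm mH H0).
- by apply: measurable_funeM; exact/measurable_EFinP.
- move=> t; rewrite in_itv/= andbT => t0.
  under eq_integral do rewrite EFinM.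
  rewrite ge0_integralZl//=; first last.
  + by rewrite lee_fin wt0.
  + by move=> z _; rewrite lee_fin G0.
  + by apply/measurable_EFinP; exact: measurable_slice mG.
  rewrite [leRHS](_ : _ = ((w t / t)%:E * (C * k t)%:E)%E).
    by rewrite lee_wpmul2l ?lee_fin ?wt0// GC.
  by rewrite -!EFinM mulrCA.
Qed.

Local Notation K := (bessel_kernel m N h alpha).
Let U x z := (\int[leb]_(t in `]0%R, +oo[) (w t / t * s x z t)%:E)%E.

Lemma bessel_kernelE x z : K x z = (alpha%:E * U x z)%E.
Proof.
rewrite /bessel_kernel; congr (_ * _)%E; apply: eq_integral => t _.
by rewrite [in LHS]mulrAC.
Qed.

Let ws0 x z t : 0 < t -> 0 <= w t / t * s x z t.
Proof.
move=> t0; have /andP[s0 _] := s_bound x z t0.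
by apply: mulr_ge0 => //; rewrite divr_ge0 ?bessel_weight_ge0// ltW.
Qed.

Let U_ge0 x z : (0 <= U x z)%E.
Proof.
by apply: integral_ge0 => t; rewrite /= in_itv/= andbT => t0; rewrite lee_fin ws0.
Qed.

Lemma bessel_kernel_ge0 x z : (0 <= K x z)%E.
Proof. by rewrite bessel_kernelE mule_ge0// lee_fin ltW. Qed.

Let measurable_U x : measurable_fun setT (U x).
Proof.
exact: (measurable_integral_halfline (measurable_weighted (s_meas x)) (ws0 x)).
Qed.

Lemma measurable_bessel_kernel x : measurable_fun setT (K x).
Proof.
rewrite (_ : K x = (fun z => alpha%:E * U x z)%E); last first.
  by apply/funext => z; exact: bessel_kernelE.
exact: measurable_funeM.
Qed.

Lemma integral_bessel_kernel x : (\int[m]_z K x z <= (2 * (B * A))%:E)%E.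
Proof.
under eq_integral do rewrite bessel_kernelE.
rewrite ge0_integralZl//; last by rewrite lee_fin ltW.
have le1 t : 0 < t -> (\int[m]_z (s x z t)%:E <= (B * A * cst 1 t)%:E)%E.
  by move=> t0; rewrite mulr1; exact: integral_approx_id.
have BA0 : 0 <= B * A by rewrite mulr_ge0 ?ltW.
have s0 z t : 0 < t -> 0 <= s x z t by move=> t0; case/andP: (s_bound x z t0).
have := weighted_tonelli_le (s_meas x) (measurable_cst (1 : R)) s0 BA0 _ le1.
move=> /(_ (fun _ _ => ler01)) le2.
apply: (@le_trans _ _ (alpha%:E * ((B * A)%:E * (2 / alpha)%:E))%E).
  rewrite lee_wpmul2l ?lee_fin ?(ltW alpha0)//; apply: (le_trans le2).
  rewrite lee_wpmul2l ?lee_fin//.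
  under eq_integral do rewrite mulr1.
  exact: bessel_weight_integral.
rewrite -!EFinM lee_fin le_eqVlt; apply/orP; left; apply/eqP.
by field; rewrite gt_eqF.
Qed.

Let integrable_K x : m.-integrable setT (K x).
Proof.
apply/integrableP; split; first exact: measurable_bessel_kernel.
under eq_integral do rewrite gee0_abs ?bessel_kernel_ge0//.
exact: le_lt_trans (integral_bessel_kernel x) (ltry _).
Qed.

(** Nonnegative substitute for the difference of the kernels at x and y, up to the factor alpha. It
    makes sense even where both kernels are infinite, and Tonelli applies to it. *)
Let Delta x y z :=
  (\int[leb]_(t in `]0%R, +oo[) (w t / t * `|s x z t - s y z t|)%:E)%E.

Let mds x y : measurable_fun (setT `*` (`]0, +oo[%classic : set R))
  (fun p : X * R => `|s x p.1 p.2 - s y p.1 p.2|).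
Proof.
by apply: measurableT_comp => //; apply: measurable_funB.
Qed.

Let wds0 x y z t : 0 < t -> 0 <= w t / t * `|s x z t - s y z t|.
Proof.
move=> t0; apply: mulr_ge0 => //.
by rewrite divr_ge0 ?bessel_weight_ge0// ltW.
Qed.

Let measurable_Delta x y : measurable_fun setT (Delta x y).
Proof.
exact: (measurable_integral_halfline (measurable_weighted (mds x y)) (wds0 x y)).
Qed.

Let Delta_ge0 x y z : (0 <= Delta x y z)%E.
Proof.
by apply: integral_ge0 => t; rewrite /= in_itv/= andbT => t0; rewrite lee_fin wds0.
Qed.

Lemma integral_bessel_difference beta x y :
  0 < beta < 1 -> beta <= alpha ->
  (\int[m]_z Delta x y z <=
   (2 * (B * A) * (beta^-1 + (1 - beta)^-1) * mdist x y `^ beta)%:E)%E.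
Proof.
move=> b01 ba; have BA0 : 0 <= 2 * (B * A) by rewrite !mulr_ge0 ?ltW.
(* Coinciding points are treated apart, since the weight integral is estimated for r > 0 only; there
   both sides are 0. *)
have := mdist_ge0 x y; rewrite le_eqVlt => /predU1P[xy0|xy0].
  have /mdist_positivity <- := esym xy0; rewrite integral0_eq.
    by rewrite mdistxx powR0 ?mulr0// gt_eqF//; case/andP: b01.
  move=> z _; rewrite /Delta integral0_eq// => t _.
  by rewrite subrr normr0 mulr0.
have k0 t : 0 < t -> 0 <= Num.min 1 (mdist x y / t).
  by move=> t0; rewrite le_min ler01 divr_ge0// ltW.
apply: (le_trans (weighted_tonelli_le (mds x y) (measurable_min_div _)
  (fun _ _ _ => normr_ge0 _) BA0 k0 (integral_approx_id_sub x y))).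
rewrite -(mulrA (2 * (B * A))) [leRHS]EFinM lee_wpmul2l ?lee_fin//.
exact: bessel_weight_integral_min.
Qed.

Section potential.
Variables (g : X -> R) (M : R).
Hypotheses (mg : measurable_fun setT g) (M0 : 0 <= M).
Hypothesis gM : {ae m, forall z, `|g z| <= M}.

Let mgK x : measurable_fun setT (fun z => (g z)%:E * K x z)%E.
Proof.
by apply: emeasurable_funM; [exact/measurable_EFinP|exact: measurable_bessel_kernel].
Qed.

Let abs_gK_le x :
  (\int[m]_z `|(g z)%:E * K x z| <= (M * (2 * (B * A)))%:E)%E.
Proof.
apply: (@le_trans _ _ (\int[m]_z (M%:E * K x z))%E).
  apply: ae_ge0_le_integral => //.
  - exact: measurableT_comp.
  - by move=> z _; rewrite mule_ge0 ?bessel_kernel_ge0 ?lee_fin.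
  - by apply: measurable_funeM; exact: measurable_bessel_kernel.
  - apply: filterS gM => z gz _.
    rewrite abseM (gee0_abs (bessel_kernel_ge0 x z)).
    by rewrite lee_wpmul2r ?bessel_kernel_ge0// lee_fin.
rewrite ge0_integralZl//;
  [|exact: measurable_bessel_kernel|by move=> z _; exact: bessel_kernel_ge0].
by rewrite EFinM lee_wpmul2l ?lee_fin//; exact: integral_bessel_kernel.
Qed.

Let integrable_gK x : m.-integrable setT (fun z => (g z)%:E * K x z)%E.
Proof.
by apply/integrableP; split => //; exact: le_lt_trans (abs_gK_le x) (ltry _).
Qed.

Local Notation J := (bessel_potential m N h alpha g).

Lemma bessel_potential_fin_num x : J x \is a fin_num.
Proof. exact: integrable_fin_num. Qed.

Lemma bessel_potential_bound x : `|fine (J x)| <= M * (2 * (B * A)).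
Proof.
rewrite -lee_fin -fine_abse ?bessel_potential_fin_num// fineK; last first.
  by rewrite abse_fin_num bessel_potential_fin_num.
exact: le_trans (le_abse_integral _ _ _) (abs_gK_le x).
Qed.

(** Multiplication by alpha > 0 keeps an infinite t-integral infinite, so a finite kernel value
    forces integrability in t. *)
Let integrable_t x z : K x z \is a fin_num ->
  leb.-integrable (`]0, +oo[%classic : set R)
    (EFin \o (fun t => w t / t * s x z t)).
Proof.
move=> Kf; apply/integrableP; split.
  apply/measurable_EFinP; apply: measurable_funM.
    exact: measurable_bessel_weight.
  apply: (@measurable_comp _ _ _ _ _ _ (setT `*` (`]0, +oo[%classic : set R))
    (fun p : X * R => s x p.1 p.2) _ (fun t => (z, t))) => //.
  - by apply: measurableX => //; exact: measurable_itv.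
  - by move=> _ [t /= t0 <-].
  - by apply: measurable_funTS; exact: pair1_measurable.
apply: (@le_lt_trans _ _ (U x z)).
  rewrite le_eqVlt; apply/orP; left; apply/eqP; apply: eq_integral => t.
  rewrite inE/= in_itv/= andbT => t0.
  by rewrite ger0_norm// ws0.
rewrite ltey; apply/eqP => Uoo; move: Kf.
by rewrite bessel_kernelE Uoo gt0_muley ?lte_fin.
Qed.

(** Being integrable, both kernels are finite for almost every z. At such z linearity merges the two
    t-integrals into one, whose absolute value is at most [Delta]. *)
Let gK_sub x y : {ae m, forall z, setT z ->
  (`|(g z)%:E * K x z - (g z)%:E * K y z| <= (M * alpha)%:E * Delta x y z)%E}.
Proof.
move: gM (integrable_ae measurableT (integrable_K x))
  (integrable_ae measurableT (integrable_K y)).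
apply: filterS3 => z gz /(_ Logic.I) Kx /(_ Logic.I) Ky _.
have ix := integrable_t Kx; have iy := integrable_t Ky.
have Ux : U x z \is a fin_num by apply: integrable_fin_num ix.
have Uy : U y z \is a fin_num by apply: integrable_fin_num iy.
have dU : (`|U x z - U y z| <= Delta x y z)%E.
  rewrite /U -integralB_EFin//.
  apply: (le_trans (le_abse_integral _ _ _)) => //.
    by apply: emeasurable_funB; [exact: measurable_int ix|exact: measurable_int iy].
  rewrite le_eqVlt; apply/orP; left; apply/eqP; apply: eq_integral => t.
  rewrite inE/= in_itv/= andbT => t0.
  rewrite -mulrBr normrM ger0_norm// divr_ge0 ?bessel_weight_ge0//.
  exact: ltW.
have E := abse_scaleB (g z) (ltW alpha0) Ux Uy.
rewrite 2!bessel_kernelE E.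
apply: lee_pmul.
- by rewrite lee_fin mulr_ge0// ltW.
- exact: abse_ge0.
- by rewrite lee_fin ler_wpM2r// ltW.
- exact: dU.
Qed.

Lemma bessel_potential_holder beta x y : 0 < beta < 1 -> beta <= alpha ->
  `|fine (J x) - fine (J y)| <=
  M * (alpha * (2 * (B * A) * (beta^-1 + (1 - beta)^-1))) * mdist x y `^ beta.
Proof.
move=> b01 ba; rewrite -lee_fin.
have -> : (`|fine (J x) - fine (J y)|%:E = `|J x - J y|)%E.
  by rewrite -[in RHS](fineK (bessel_potential_fin_num x))
    -[in RHS](fineK (bessel_potential_fin_num y)).
rewrite /bessel_potential -integralB//.
apply: (le_trans (le_abse_integral _ _ _)) => //.
  exact: emeasurable_funB.
apply: (@le_trans _ _ (\int[m]_z ((M * alpha)%:E * Delta x y z))%E).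
  apply: ae_ge0_le_integral => //.
  - by apply: measurableT_comp => //; exact: emeasurable_funB.
  - by move=> z _; rewrite mule_ge0// lee_fin mulr_ge0// ltW.
  - exact: measurable_funeM.
have Ma0 : 0 <= M * alpha by rewrite mulr_ge0// ltW.
rewrite ge0_integralZl//.
apply: (@le_trans _ _ ((M * alpha)%:E * (2 * (B * A) *
   (beta^-1 + (1 - beta)^-1) * mdist x y `^ beta)%:E)%E).
  by rewrite lee_wpmul2l ?lee_fin//; exact: integral_bessel_difference.
by rewrite -EFinM !mulrA.
Qed.

End potential.
End bessel_kernel_estimates.

(** * Holder regularity of potentials *)

Section regularity.
Context (d : measure_display) (R : realType) (X : measurableMetricType d R).
Variables (m : {measure set X -> \bar R}) (N : R) (h : R -> R).
Hypotheses (borelX : borel_sigma_algebra X) (mX : m [set: X] = +oo%E).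
Hypotheses (regm : ahlfors_regular m N) (hcut : cutoff h).

Lemma bessel_potential_regularity (alpha beta : R) :
  0 < beta < 1 -> beta <= alpha ->
  exists2 C, 0 < C & forall (g : X -> R) (M : R),
    measurable_fun setT g -> 0 <= M -> {ae m, forall z, `|g z| <= M} ->
    let J := bessel_potential m N h alpha g in
    [/\ forall x, J x \is a fin_num, forall x, `|fine (J x)| <= M * C
      & forall x y, `|fine (J x) - fine (J y)| <= M * C * mdist x y `^ beta].
Proof.
move=> b01 ba; have /andP[b0 b1] := b01.
have alpha0 : 0 < alpha by exact: lt_le_trans ba.
(* Sigma-finiteness is obtained from balls about a point; an empty space would have measure 0. *)
have [x0 _] : [set: X] !=set0.
  by apply/set0P/eqP => X0; move: mX; rewrite X0 measure0.
have sm := ahlfors_sigma_finite x0 borelX regm.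
have [c c0 regc] := regm; have [L L0 lip_h] := cutoff_lipschitz hcut.
have [B B0 [s1 s2 s3 s4]] := approx_id_estimates borelX c0 L0 regc hcut lip_h.
pose C1 := 2 * (B * (c * 4 `^ N)).
pose C2 := alpha * (C1 * (beta^-1 + (1 - beta)^-1)).
have C10 : 0 < C1 by rewrite !mulr_gt0// powR_gt0.
have C20 : 0 < C2.
  by rewrite !mulr_gt0// addr_gt0// invr_gt0// subr_gt0.
(* [C1] bounds the values and [C2] the Holder quotients; their sum serves for both. *)
exists (C1 + C2) => [|g M mg M0 gM J]; first exact: addr_gt0.
split=> [x|x|x y].
- exact: (bessel_potential_fin_num borelX c0 B0 sm regc s1 s2 s4 alpha0 mg M0 gM).
- apply: (le_trans (bessel_potential_bound borelX c0 B0 sm regc s1 s2 s4 alpha0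
    mg M0 gM x)).
  by rewrite ler_wpM2l// lerDl ltW.
- apply: (le_trans (bessel_potential_holder borelX c0 B0 sm regc s1 s2 s3 s4 alpha0
    mg M0 gM x y b01 ba)).
  by rewrite ler_wpM2r ?powR_ge0// ler_wpM2l// lerDr ltW.
Qed.

Lemma Lfun_infty_bound (g : X -> R) : g \in Lfun m +oo%E ->
  exists M, [/\ 0 <= M, Lnorm m +oo%E (EFin \o g) = M%:E,
    measurable_fun setT g & {ae m, forall z, `|g z| <= M}].
Proof.
move=> gL; have mg : measurable_fun setT g.
  by have := sub_Lfun_mfun gL; rewrite inE.
have := sub_Lfun_finLfun gL; rewrite inE /= /finite_norm => Noo.
have N0 : (0 <= Lnorm m +oo%E (EFin \o g))%E by exact: Lnorm_ge0.
have Nf : Lnorm m +oo%E (EFin \o g) \is a fin_num by rewrite ge0_fin_numE.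
exists (fine (Lnorm m +oo%E (EFin \o g))); split => //.
- exact: fine_ge0.
- by rewrite fineK.
- have := @ess_sup_ge _ _ _ m (abse \o (EFin \o g)).
  apply: filterS => z; rewrite -lee_fin fineK// => gz.
  (* The norm at exponent infinity is the essential supremum when the whole space has positive
     measure, which [mX] provides. *)
  by rewrite unlock mX ltry.
Qed.

Lemma ae_eq_continuous (f1 f2 : X -> R) : continuous f1 -> continuous f2 ->
  f1 = f2 %[ae m] -> f1 = f2.
Proof.
move=> c1 c2 f12; apply/funext => x; apply/eqP; apply: contraT => f12x.
have cf : continuous (fun y => `|f1 y - f2 y|).
  by move=> y; apply: cvg_norm; apply: cvgB; [exact: c1|exact: c2].
have [c c0 regc] := regm.
have : \forall y \near x, 0 < `|f1 y - f2 y|.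
  apply: (cvgr_gt _ (cf x)); by rewrite normr_gt0 subr_eq0.
move=> /nbhs_ballP[r /= r0 rx].
have /andP[+ _] := regc x r r0.
have [Z [mZ Z0 ncZ]] := f12.
have -> : m (ball x r) = 0%E.
  apply: (subset_measure0 _ mZ) => //; first exact: measurable_mball.
  move=> y /rx fy; apply: ncZ => /(_ Logic.I) fE.
  by move: fy; rewrite fE subrr normr0 ltxx.
by rewrite lee_fin leNgt mulr_gt0 ?invr_gt0 ?powR_gt0.
Qed.

Lemma holder_continuous (beta K : R) (f : X -> R) : 0 < beta ->
  (forall x y, `|f x - f y| <= K * mdist x y `^ beta) -> continuous f.
Proof.
move=> b0 fK x; apply/cvgrPdist_lt => e e0.
have K0 : 0 < `|K| + 1 by rewrite ltr_wpDl.
have r0 : 0 < e / (`|K| + 1) by rewrite divr_gt0.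
(* The radius r solves [(|K| + 1) r^beta = e]; the added 1 allows for [K = 0]. *)
apply/nbhs_ballP; exists ((e / (`|K| + 1)) `^ beta^-1) => /=; first exact: powR_gt0.
move=> y; rewrite ballEmdist/= => xy.
apply: (le_lt_trans (fK x y)).
have lt1 : mdist x y `^ beta < e / (`|K| + 1).
  rewrite [ltRHS](_ : _ = ((e / (`|K| + 1)) `^ beta^-1) `^ beta).
    by rewrite gt0_ltr_powR// nnegrE ?mdist_ge0 ?powR_ge0.
  by rewrite -powRrM mulVf ?gt_eqF// powRr1// ltW.
rewrite -(@ltr_pM2l _ (`|K| + 1))// mulrCA divff ?gt_eqF// mulr1 in lt1.
apply: le_lt_trans lt1; rewrite ler_wpM2r ?powR_ge0//.
by rewrite (le_trans (ler_norm K))// lerDl.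
Qed.

Lemma potential_representative (alpha beta : R) :
  0 < beta < 1 -> beta <= alpha ->
  exists2 C, 0 < C & forall f, potential_space m N h alpha f ->
    exists f' : X -> R, [/\ f = f' %[ae m], continuous f',
      holder_space beta f' &
      (holder_norm beta f' <= C%:E * potential_norm m N h alpha f)%E].
Proof.
move=> b01 ba; have /andP[b0 _] := b01.
have [C C0 HC] := bessel_potential_regularity b01 ba.
have C20 : 0 < 2 * C by rewrite mulr_gt0.
(* One [C] for the supremum norm and one for the Holder seminorm. *)
exists (2 * C) => // f [g gL fg].
have aeE g' : g' \in Lfun m +oo%E -> is_bessel_potential m N h alpha g' f ->
    f = (fun x => fine (bessel_potential m N h alpha g' x)) %[ae m].
  by move=> _; apply: filterS => x /(_ Logic.I) /= fE _; rewrite -fE.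
have cont g' : g' \in Lfun m +oo%E ->
    continuous (fun x => fine (bessel_potential m N h alpha g' x)).
  move=> /Lfun_infty_bound[M [M0 _ mg gM]].
  have [_ _ HJ] := HC g' M mg M0 gM; exact: holder_continuous HJ.
exists (fun x => fine (bessel_potential m N h alpha g x)); split.
- exact: aeE.
- exact: cont.
- have [M [M0 _ mg gM]] := Lfun_infty_bound gL.
  have [_ bJ HJ] := HC g M mg M0 gM.
  by split; [exists (M * C)|exists (M * C)].
- (* Every g with J g = f a.e. gives the same continuous representative, so the
     bound by a multiple of the norm of g passes to the infimum over g. *)
  rewrite /potential_norm.
  apply: (@le_trans _ _ ((2 * C)%:E * ereal_inf [set Lnorm m +oo%E (EFin \o g') | g' in
    [set g' : X -> R | g' \in Lfun m +oo%E /\ is_bessel_potential m N h alpha g' f]])%E).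
    (* Division by [2 * C] turns the claim into a lower bound for the infimum, tested on each [g']
       separately. *)
    rewrite -lee_pdivrMl//; apply: le_ereal_inf_tmp => _ [g' [g'L fg'] <-].
    rewrite lee_pdivrMl//.
    have -> : (fun x => fine (bessel_potential m N h alpha g x)) =
        (fun x => fine (bessel_potential m N h alpha g' x)).
      apply: ae_eq_continuous; [exact: cont|exact: cont|].
      apply: ae_eq_trans (aeE _ g'L fg').
      by apply: ae_eq_sym; exact: aeE.
    have [M [M0 NM mg gM]] := Lfun_infty_bound g'L.
    have [_ bJ HJ] := HC g' M mg M0 gM.
    rewrite NM -EFinM (_ : 2 * C * M = M * C + M * C); last by ring.
    rewrite EFinD; apply: leeD.
      by apply: ge_ereal_sup => _ [x _ <-]; rewrite lee_fin.
    apply: ge_ereal_sup => _ [[x y] /= xy <-]; rewrite lee_fin ler_pdivrMr//.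
    by rewrite powR_gt0// mdist_gt0.
  (* The infimum alone suffices; the sup norm of [f] is nonnegative and only enlarges the right-hand
     side. *)
  rewrite lee_wpmul2l ?lee_fin ?(ltW C20)// leeDr//.
  exact: Lnorm_ge0.
Qed.

End regularity.

Theorem corollary4p5 (R : realType) (d : measure_display)
    (X : measurableMetricType d R) (m : {measure set X -> \bar R})
    (N : R) (h : R -> R) :
  borel_sigma_algebra X -> m [set: X] = +oo%E ->
  0 < N -> ahlfors_regular m N -> cutoff h ->
  [/\ forall alpha : R, 0 < alpha < 1 ->
        continuously_embeds m
          (potential_space m N h alpha) (potential_norm m N h alpha)
          (holder_space alpha) (holder_norm alpha),
      forall alpha : R, 1 <= alpha -> forall beta : R, 0 < beta < 1 ->
        continuously_embeds m
          (potential_space m N h alpha) (potential_norm m N h alpha)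
          (holder_space beta) (holder_norm beta)
    & forall alpha : R, 0 < alpha -> forall f : X -> R,
        potential_space m N h alpha f ->
        exists2 f' : X -> R, continuous f' & f = f' %[ae m]].
Proof.
move=> borelX mX N0 regm hcut.
have rep := potential_representative borelX mX regm hcut.
split=> [alpha a01|alpha a1 beta b01|alpha a0 f fP].
- have [C _ HC] := rep alpha alpha a01 (lexx _).
  by exists C => f /HC[f' [ff' _ hf' nf']]; exists f'.
- have ba : beta <= alpha by case/andP: b01 => _ /ltW b1; exact: le_trans a1.
  have [C _ HC] := rep alpha beta b01 ba.
  by exists C => f /HC[f' [ff' _ hf' nf']]; exists f'.
(* The exponent [min(alpha, 1/2)] lies in ]0, 1[ and does not exceed alpha, so continuity needs no
   case distinction on alpha. *)
- have [||C _ /(_ f fP)[f' [ff' cf' _ _]]] := rep alpha (Num.min alpha 2^-1).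
  + rewrite lt_min a0 invr_gt0 ltr0n/= gt_min; apply/orP; right.
    by rewrite invf_lt1// ltr1n.
  + by rewrite ge_min lexx.
  + by exists f'.
Qed.
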